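(* Let $E$ be a real $d\times d$ matrix whose eigenvalues all have positive real parts, let $a_1>0$ be the smallest real part of the eigenvalues of $E$, let $E^t$ be the transpose of $E$, and let $q=\operatorname{trace}(E)$. Let $\psi:\mathbb{R}^d\to[0,\infty)$ be a continuous, $E^t$-homogeneous function such that $\psi(x)\neq0$ for $x\ne0$. Let $0<\alpha\le 2$ and $H\in(0,a_1)$, and let $$X_\psi(x)=\operatorname{Re}\int_{\mathbb{R}^d}\Bigl(e^{i\langle x,\xi\rangle}-1\Bigr)\psi(\xi)^{-H-q/\alpha}\,W_\alpha(d\xi),\qquad x\in\mathbb{R}^d.$$ Then the random field $\{X_\psi(x)\}_{x\in\mathbb{R}^d}$ has the following properties: (a) operator scaling: for any $c>0$, the fields $\{X_\psi(c^Ex)\}_{x\in\mathbb{R}^d}$ and $\{c^HX_\psi(x)\}_{x\in\mathbb{R}^d}$ have the same finite-dimensional distributions; (b) stationary increments: for any $h\in\mathbb{R}^d$, the fields $\{X_\psi(x+h)-X_\psi(h)\}_{x\in\mathbb{R}^d}$ and $\{X_\psi(x)\}_{x\in\mathbb{R}^d}$ have the same finite-dimensional distributions.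
   Context: For $c>0$ and a square matrix $A$, $c^A=\exp(A\log c)$ (matrix exponential). A function $\psi$ on $\mathbb{R}^d$ is $E^t$-homogeneous if $\psi(c^{E^t}x)=c\psi(x)$ for all $c>0$ and $x\neq0$. $\langle\cdot,\cdot\rangle$ is the standard inner product. $W_\alpha(d\xi)$ is a complex isotropic symmetric $\alpha$-stable ($S\alpha S$) random measure on $\mathbb{R}^d$ with Lebesgue control measure. For a measurable $f:\mathbb{R}^d\to\mathbb{C}$ the integral $\int f\,dW_\alpha$ exists if and only if $\int_{\mathbb{R}^d}|f(\xi)|^\alpha d\xi<\infty$; it is linear in $f$, and $Y=\operatorname{Re}\int f\,dW_\alpha$ has characteristic function $\mathbb{E}(e^{itY})=\exp(-c_0|t|^\alpha\int|f(\xi)|^\alpha d\xi)$ with a constant $c_0>0$ depending only on $\alpha$. Under the stated hypotheses the integral defining $X_\psi(x)$ exists for every $x\in\mathbb{R}^d$. *)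

(* Defs.v *)
From HB Require Import structures.
From mathcomp Require Import all_boot all_order all_algebra.
From mathcomp Require Import all_classical all_reals all_analysis.
From mathcomp Require Import complex.

Set Implicit Arguments.
Unset Strict Implicit.
Unset Printing Implicit Defensive.

Import Order.TTheory GRing.Theory Num.Theory.
Import numFieldNormedType.Exports.

Local Open Scope classical_set_scope.
Local Open Scope ring_scope.

Section matrices.
Context {R : realType} {d : nat}.
Implicit Types (A : 'M[R]_d) (x y : 'cV[R]_d).

Definition mexp A : 'M[R]_d := limn (series (fun k => k`!%:R^-1 *: A ^+ k)).

Definition mpow (c : R) A : 'M[R]_d := mexp (ln c *: A).

Definition inner x y : R := \sum_(i < d) x i 0 * y i 0.

Definition is_complex_eigenvalue A (z : R[i]) : Prop :=
  eigenvalue (map_mx (real_complex R) A) z.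

Definition homogeneous A (psi : 'cV[R]_d -> R) : Prop :=
  forall (c : R) x, 0 < c -> x != 0 -> psi (mpow c A *m x) = c * psi x.

End matrices.

(* The product sigma-algebra of the d copies of the Borel sigma-algebra of R
   (this is the Borel sigma-algebra of R^d). *)
Section measurable_cV.
Context {R : realType} {d : nat}.

Let coord (i : 'I_d) (x : 'cV[R]_d) : R := x i 0.

Let cV_set0 : g_sigma_preimage coord set0.
Proof. exact: sigma_algebra0. Qed.

Let cV_setC A : g_sigma_preimage coord A -> g_sigma_preimage coord (~` A).
Proof. exact: sigma_algebraC. Qed.

Let cV_bigcup (F : (set 'cV[R]_d)^nat) :
  (forall i, g_sigma_preimage coord (F i)) ->
  g_sigma_preimage coord (\bigcup_i (F i)).
Proof. exact: sigma_algebra_bigcup. Qed.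

HB.instance Definition _ :=
  @isMeasurable.Build (measure_tuple_display default_measure_display)
    'cV[R]_d (g_sigma_preimage coord) cV_set0 cV_setC cV_bigcup.

End measurable_cV.

Section lebesgue_cV.
Context {R : realType}.

Lemma measurable_coord d (i : 'I_d) :
  measurable_fun setT (fun x : 'cV[R]_d => x i 0).
Proof.
move=> _ Y mY; rewrite setTI; apply: sub_sigma_algebra => /=.
rewrite -bigcup_seq/=; exists i => /=; first by rewrite mem_index_enum.
by exists Y => //; rewrite setTI.
Qed.

Lemma measurable_fun_coordP d disp (T : measurableType disp)
    (f : T -> 'cV[R]_d) :
  (forall i, measurable_fun setT (fun t => f t i 0)) -> measurable_fun setT f.
Proof.
move=> mf _ Y; rewrite setTI.
suff : g_sigma_preimage (fun i (x : 'cV[R]_d) => x i 0) `<=`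
    image_set_system setT f measurable.
  by move=> H /H; rewrite /image_set_system /= setTI.
apply: smallest_sub.
  exact/sigma_algebra_image/sigma_algebra_measurable.
rewrite -bigcup_seq/= => A [i /= _] [B mB <-].
rewrite /image_set_system /= !setTI.
by have := mf i measurableT B mB; rewrite setTI.
Qed.

Definition consV d (p : measurableTypeR R * 'cV[R]_d) : 'cV[R]_d.+1 :=
  col_mx (p.1%:M : 'cV[R]_1) p.2.

Definition unconsV d (x : 'cV[R]_d.+1) : measurableTypeR R * 'cV[R]_d :=
  (x 0 0, @dsubmx R 1 d 1 x).

Lemma unconsVK d : cancel (@unconsV d) (@consV d).
Proof.
move=> x; apply/matrixP => i j; rewrite ord1 /consV /unconsV /=.
rewrite -[x in RHS](@vsubmxK R 1 d 1).
suff -> : (x 0 0)%:M = @usubmx R 1 d 1 x by [].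
by apply/matrixP => a b; rewrite !ord1 !mxE eqxx mulr1n; congr (x _ _);
  exact/val_inj.
Qed.

Lemma consVK d : cancel (@consV d) (@unconsV d).
Proof.
move=> [a x]; rewrite /consV /unconsV /= (@col_mxKd R 1 d 1); congr pair.
have -> : (0 : 'I_d.+1) = @lshift 1 d 0 by exact/val_inj.
by rewrite (@col_mxEu R 1 d 1) mxE eqxx mulr1n.
Qed.

Lemma measurable_consV d : measurable_fun setT (@consV d).
Proof.
apply: measurable_fun_coordP => i.
have [j|j] := @split_ordP 1 d i.
  move=> ->; rewrite (_ : (fun _ => _) = fst); first exact: measurable_fst.
  by apply/funext => p; rewrite /consV (@col_mxEu R 1 d 1) ord1 mxE eqxx mulr1n.
move=> ->.
rewrite (_ : (fun _ => _) = (fun x : 'cV[R]_d => x j 0) \o snd).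
  by apply: measurableT_comp; [exact: measurable_coord|exact: measurable_snd].
by apply/funext => p; rewrite /consV (@col_mxEd R 1 d 1).
Qed.

Lemma measurable_unconsV d : measurable_fun setT (@unconsV d).
Proof.
apply: measurable_fun_pair; first exact: (@measurable_coord d.+1 0).
apply: measurable_fun_coordP => i.
rewrite (_ : (fun _ => _) = fun x : 'cV[R]_d.+1 => x (rshift 1 i) 0).
  exact: measurable_coord.
by apply/funext => x; rewrite mxE.
Qed.

HB.instance Definition _ d := isMeasurableFun.Build _ _ _ _ (@consV d)
  (@measurable_consV d).

Section cons_measure.
Variables (d : nat) (m : {sigma_finite_measure set 'cV[R]_d -> \bar R}).

Definition cons_measure : set 'cV[R]_d.+1 -> \bar R :=
  pushforward (lebesgue_measure \x m)%E (@consV d).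

Let cons_measure0 : cons_measure set0 = 0%E.
Proof. exact: measure0. Qed.

Let cons_measure_ge0 A : (0 <= cons_measure A)%E.
Proof. exact: measure_ge0. Qed.

Let cons_measure_sigma_additive : semi_sigma_additive cons_measure.
Proof. exact: measure_semi_sigma_additive. Qed.

HB.instance Definition _ := isMeasure.Build _ _ _ cons_measure
  cons_measure0 cons_measure_ge0 cons_measure_sigma_additive.

Let cons_measure_sigma_finite : sigma_finite setT cons_measure.
Proof.
have /sigma_finiteP[F [TF ndF Foo]] := sigma_finiteT (@lebesgue_measure R).
have /sigma_finiteP[G [TG ndG Goo]] := sigma_finiteT m.
exists (fun k => @unconsV d @^-1` (F k `*` G k)).
  rewrite -preimage_bigcup (_ : \bigcup_k _ = setT) ?preimage_setT//.
  rewrite -subTset => -[x y] _.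
  have [a _ Fax] : (\bigcup_i F i) x by rewrite -TF.
  have [b _ Gby] : (\bigcup_i G i) y by rewrite -TG.
  exists (maxn a b) => //; split => /=.
  - by move: x Fax; exact/subsetPset/ndF/leq_maxl.
  - by move: y Gby; exact/subsetPset/ndG/leq_maxr.
move=> k; have [mF Fk] := Foo k; have [mG Gk] := Goo k; split.
  rewrite -[X in measurable X]setTI; apply: measurable_unconsV => //.
  exact: measurableX.
rewrite /cons_measure /pushforward -comp_preimage.
rewrite (_ : _ \o _ = id) ?preimage_id; last first.
  by apply/funext => p; exact: consVK.
by rewrite product_measure1E// lte_mul_pinfty// ge0_fin_numE.
Qed.

HB.instance Definition _ := Measure_isSigmaFinite.Build _ _ _ cons_measure
  cons_measure_sigma_finite.

End cons_measure.

(* The Lebesgue measure on R^(d+1) is the product of the Lebesgue measures on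
   R and R^d; on R^0 it is the Dirac mass at the only point. *)
Fixpoint lebesgue_cV (d : nat) : {sigma_finite_measure set 'cV[R]_d -> \bar R} :=
  match d with
  | 0 => @dirac _ 'cV[R]_0 0 R
  | d'.+1 => cons_measure (lebesgue_cV d')
  end.

End lebesgue_cV.

Section complex_functions.
Context {R : realType}.

Definition modulus (z : R[i]) : R := complex.ComplexField.Normc.normc z.

Definition expi (t : R) : R[i] := Complex (cos t) (sin t).

(* C is identified with R^2 as a measurable space. *)
Definition re_im (z : R[i]) : R * R := (complex.Re z, complex.Im z).

Definition measurable_complex d (T : measurableType d) (f : T -> R[i]) : Prop :=
  measurable_fun setT (re_im \o f).

End complex_functions.

Section probability.
Context {R : realType} {d : measure_display} {Omega : measurableType d}.
Variable P : probability Omega R.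

(* The characteristic function E exp(i Re (z^* Z)) of Z, viewed as a random
   vector of R^2. *)
Definition char_fun (Z : Omega -> R[i]) (z : R[i]) : R[i] :=
  let phase w := complex.Re (conjc z * Z w) in
  Complex (\int[P]_w cos (phase w)) (\int[P]_w sin (phase w)).

(* The choice B i = setT gives the product rule for the subfamilies. *)
Definition mutually_independent d' (T : measurableType d') n
    (Y : 'I_n -> Omega -> T) : Prop :=
  forall B : 'I_n -> set T, (forall i, measurable (B i)) ->
    P (\bigcap_(i in setT) (Y i @^-1` B i)) =
    (\prod_(i < n) P (Y i @^-1` B i))%E.

Definition cvg_in_probability (Z : nat -> Omega -> R[i]) (Y : Omega -> R[i]) :
    Prop :=
  forall eps : R, 0 < eps ->
    P [set w | eps <= modulus (Z k w - Y w)] @[k --> \oo] --> 0%E.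

Definition same_fdd (T : Type) (X Y : T -> Omega -> R) : Prop :=
  forall n (x : n.-tuple T) (B : set (n.-tuple R)), measurable B ->
    pushforward P (fun w => [tuple X (tnth x i) w | i < n]) B =
    pushforward P (fun w => [tuple Y (tnth x i) w | i < n]) B.

End probability.

Section stable.
Context {R : realType} {d d' : measure_display} {Omega : measurableType d}
  {T : measurableType d'}.
Variables (P : probability Omega R) (m : {measure set T -> \bar R}).
Variables (alpha c0 : R).

Definition finite_measurable (A : set T) : Prop :=
  measurable A /\ (m A < +oo)%E.

(* A complex random variable is isotropic SaS with scale s when its
   characteristic function is z |-> exp(- c0 s^alpha |z|^alpha); for W A the
   scale satisfies s^alpha = m A, where m is the control measure.  The constant
   c0 is the normalization of W.  Only the values of W on the sets of finite
   measure matter. *)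
Record isotropic_SaS_random_measure (W : set T -> Omega -> R[i]) : Prop := {
  SaS_measurable : forall A, finite_measurable A -> measurable_complex (W A) ;
  SaS_char_fun : forall A (z : R[i]), finite_measurable A ->
    char_fun P (W A) z =
    (expR (- (c0 * modulus z `^ alpha * fine (m A))))%:C%C ;
  SaS_independently_scattered : forall n (A : 'I_n -> set T),
    (forall i, finite_measurable (A i)) -> trivIset setT A ->
    mutually_independent P (fun i => re_im \o W (A i)) ;
  SaS_sigma_additive : forall A : nat -> set T,
    (forall k, finite_measurable (A k)) -> trivIset setT A ->
    finite_measurable (\bigcup_k A k) ->
    {ae P, forall w,
      modulus (\sum_(0 <= k < n) W (A k) w - W (\bigcup_k A k) w)
        @[n --> \oo] --> 0}
}.

(* The list s of pairs (z_j, A_j) encodes the simple function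
   sum_j z_j 1_(A_j). *)
Definition simple_data (s : seq (R[i] * set T)) : Prop :=
  forall p, p \in s -> finite_measurable p.2.

Definition simple_fun (s : seq (R[i] * set T)) (x : T) : R[i] :=
  \sum_(p <- s) p.1 * (\1_(p.2) x)%:C%C.

Definition simple_integral (W : set T -> Omega -> R[i])
    (s : seq (R[i] * set T)) (w : Omega) : R[i] :=
  \sum_(p <- s) p.1 * W p.2 w.

(* Y is (a version of) the integral of f with respect to W: the limit in
   probability of the integrals of simple functions which converge to f in
   L^alpha(m).  Such a Y is unique up to a null set. *)
Definition is_stochastic_integral (W : set T -> Omega -> R[i])
    (f : T -> R[i]) (Y : Omega -> R[i]) : Prop :=
  [/\ measurable_complex f,
      measurable_complex Y
    & exists s : nat -> seq (R[i] * set T),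
      [/\ forall k, simple_data (s k),
          (\int[m]_x (modulus (f x - simple_fun (s k) x) `^ alpha)%:E)%E
            @[k --> \oo] --> 0%E
        & cvg_in_probability P (fun k => simple_integral W (s k)) Y]].

End stable.

(* At xi = 0, where psi vanishes, the kernel is 0 because of its first factor. *)
Definition harmonizable_kernel (R : realType) (d : nat) (psi : 'cV[R]_d -> R)
    (beta : R) (x xi : 'cV[R]_d) : R[i] :=
  (expi (inner x xi) - 1) * (psi xi `^ beta)%:C%C.

(* Main.v *)
Require Import Defs.
From mathcomp Require Import all_boot all_order all_algebra.
From mathcomp Require Import all_classical all_reals all_analysis.
From mathcomp Require Import complex measurable_realfun ring lra.

(** Real linear combinations of the X x are real parts of stochastic integrals, and the
    real part of the integral of f has the characteristic function
    exp (- c0 |t|^alpha int |f|^alpha).  So two families of such integrals have the same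
    finite-dimensional distributions as soon as the integrals of |f|^alpha, called
    energies below, agree for all real linear combinations of their kernels
    (same_fdd_stochastic_integral).  Both properties are then computations with the kernel
    f_x(xi) = (exp (i <x, xi>) - 1) psi(xi)^beta, where beta = - H - q / alpha.

    For stationary increments, f_(x + h) - f_h is f_x times the phase exp (i <h, xi>),
    which is common to all x and has modulus 1 (kernel_shift).

    For operator scaling, the kernel at c^E x is c^(- beta) times f_x evaluated at M xi,
    with M = c^(E^T), because <c^E x, xi> = <x, M xi> and psi (M xi) = c psi(xi)
    (kernel_scale).  The change of variables M contributes the factor 1 / det M = c^(- q),
    and c^(- beta alpha) c^(- q) = c^(H alpha), which is the factor produced by c^H.

    Four facts carry this argument.
    - The determinant of c^E is c^(tr E) (det_mexp): the exponential of A is the limit of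
      (1 + A / n)^n, and det (1 + A / n) = 1 + tr A / n + O(1 / n^2).
    - A linear change of variables divides the Lebesgue measure by the modulus of the
      determinant (lebesgue_scaling_unit), by Gaussian elimination into shears and
      diagonal blocks, for which it follows from the theorem of Fubini and Tonelli.
    - Expectations of cosines of affine forms determine the law of a random vector
      (eq_distribution): indicators of quadrants are bounded limits of trigonometric
      polynomials.
    - The characteristic function of a stochastic integral
      (expectation_cos_stochastic_integral): a simple function is cut into disjoint atoms,
      on which the random measure is independent, and the general case follows by a limit
      in probability. *)

Import Order.TTheory GRing.Theory Num.Theory.
Import numFieldNormedType.Exports.

Set Implicit Arguments.
Unset Strict Implicit.
Unset Printing Implicit Defensive.

Local Open Scope classical_set_scope.
Local Open Scope ring_scope.

(** * The matrix exponential and its determinant *)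

Section mexp.
Context {R : realType}.

Lemma cvg_mxP d e (F : nat -> 'M[R]_(d, e)) (L : 'M[R]_(d, e)) :
  (forall i j, F n i j @[n --> \oo] --> L i j) -> F @ \oo --> L.
Proof.
move=> FL A [P LP PA].
have : \forall n \near \oo, forall i j, P i j (F n i j).
  by apply: filter_forall => i; apply: filter_forall => j; exact/FL/LP.
by apply: filterS => n PF; exact: PA.
Qed.

Lemma cvg_det d (F : nat -> 'M[R]_d) (L : 'M[R]_d) :
  (forall i j, F n i j @[n --> \oo] --> L i j) ->
  \det (F n) @[n --> \oo] --> \det L.
Proof.
move=> FL; rewrite /determinant.
apply: cvg_big => [|s _]; first by move=> /= x; exact: add_continuous.
apply: cvgMl_tmp; apply: cvg_big => [|i _]; last exact: FL.
by move=> /= x; exact: mul_continuous.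
Qed.

Section powers.
Variables (d : nat) (A : 'M[R]_d).

(** The entries of A ^+ k are bounded by the k-th power of this norm, so that scalar
    exponential series dominate the entries of the matrix exponential. *)
Definition entries_sum : R := \sum_i \sum_j `|A i j|.

Lemma entries_sum_ge0 : 0 <= entries_sum.
Proof. by apply: sumr_ge0 => i _; exact: sumr_ge0. Qed.

Lemma ler_expmx_entry k i j : `|(A ^+ k) i j| <= entries_sum ^+ k.
Proof.
elim: k i => [|k IHk] i.
  by rewrite !expr0 mxE; case: (i == j); rewrite ?normr1 ?normr0.
rewrite !exprS mxE (le_trans (ler_norm_sum _ _ _))//.
under eq_bigr do rewrite normrM.
apply: (@le_trans _ _ (\sum_l `|A i l| * entries_sum ^+ k)).
  by apply: ler_sum => l _; rewrite ler_wpM2l.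
rewrite -mulr_suml ler_wpM2r ?exprn_ge0 ?entries_sum_ge0//.
rewrite /entries_sum [leRHS](bigD1 i)//= lerDl.
by apply: sumr_ge0 => l _; exact: sumr_ge0.
Qed.

Lemma is_cvg_mexp_entry i j :
  cvgn (series (fun k => k`!%:R^-1 * (A ^+ k) i j)).
Proof.
apply: (@normed_cvg R R^o).
apply: (series_le_cvg _ _ _ (is_cvg_series_exp_coeff entries_sum)) => k /=.
- exact: normr_ge0.
- by rewrite divr_ge0 ?exprn_ge0 ?entries_sum_ge0.
- by rewrite normrM ger0_norm ?invr_ge0// mulrC ler_wpM2r ?invr_ge0// ler_expmx_entry.
Qed.

Lemma mexpE : mexp A =
  \matrix_(i, j) limn (series (fun k => k`!%:R^-1 * (A ^+ k) i j)).
Proof.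
apply/cvg_lim; first exact: norm_hausdorff.
apply: cvg_mxP => i j; rewrite mxE.
rewrite (_ : (fun n => _) = series (fun k => k`!%:R^-1 * (A ^+ k) i j)).
  exact: is_cvg_mexp_entry.
apply/funext => n; rewrite /series/= summxE.
by apply: eq_bigr => k _; rewrite mxE.
Qed.

Lemma cvg_mexp_partial i j :
  \sum_(k < n.+2) k`!%:R^-1 * (A ^+ k) i j @[n --> \oo] --> mexp A i j.
Proof.
rewrite mexpE mxE.
rewrite (_ : (fun n => _) =
    (fun n => series (fun k => k`!%:R^-1 * (A ^+ k) i j) (n + 2)%N)).
  by rewrite cvg_shiftn; exact: is_cvg_mexp_entry.
by apply/funext => n; rewrite /series/= addn2 big_mkord.
Qed.

End powers.

Lemma mexp_tr d (A : 'M[R]_d) : mexp A^T = (mexp A)^T.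
Proof.
rewrite !mexpE; apply/matrixP => i j; rewrite !mxE; congr (limn (series _)).
apply/funext => k; suff -> : A^T ^+ k = (A ^+ k)^T by rewrite mxE.
by elim: k => [|k IHk]; rewrite ?expr0 ?trmx1// exprS IHk exprSr trmx_mul.
Qed.

(** Squeeze: 1 + x <= expR x, and the same inequality applied to - x / (1 + x)
    gives expR (x / (1 + x)) <= 1 + x when 1 + x > 0. *)
Lemma cvg_compound (x : nat -> R) (t : R) :
  x @ \oo --> 0 -> n.+1%:R * x n @[n --> \oo] --> t ->
  (1 + x n) ^+ n.+1 @[n --> \oo] --> expR t.
Proof.
move=> x0 nxt.
apply: (@squeeze_cvgr _ _ _ _ (fun n => expR (n.+1%:R * x n / (1 + x n)))
  (fun n => expR (n.+1%:R * x n))).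
- near=> n.
  have x1 : 0 < 1 + x n.
    rewrite -ltrBlDl sub0r; near: n; apply: (cvgr_gt 0) => //.
  rewrite -mulrA !expRM_natl !ler_pXn2r ?nnegrE ?expR_ge0 ?(ltW x1)// expR_ge1Dx andbT.
  rewrite -[leRHS]invrK -[x n / _]opprK expRN lef_pV2 ?posrE ?invr_gt0 ?expR_gt0//.
  apply: le_trans (expR_ge1Dx _); rewrite le_eqVlt; apply/orP; left; apply/eqP.
  by field; rewrite gt_eqF.
- apply: (continuous_cvg _ (@continuous_expR R t)).
  rewrite -[X in _ --> X]divr1 -[X in _ / X]addr0.
  apply: cvgM => //; apply: cvgV; first by rewrite addr0 oner_neq0.
  by apply: cvgD => //; exact: cvg_cst.
- exact: (continuous_cvg _ (@continuous_expR R t)).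
Unshelve. all: by end_near. Qed.

Lemma ffact_le_expn m k : (m ^_ k <= m ^ k)%N.
Proof.
elim: k => [|k IHk]; first by rewrite ffactn0 expn0.
by rewrite ffactnSr expnSr leq_mul// leq_subr.
Qed.

Lemma exprZmx d (c : R) (A : 'M[R]_d) k : (c *: A) ^+ k = c ^+ k *: A ^+ k.
Proof.
elim: k => [|k IHk]; first by rewrite !expr0 scale1r.
rewrite !exprS IHk -!mulmxE -[LHS]scalemxAl -scalemxAr.
by rewrite scalerA.
Qed.

(** The coefficient of A ^+ k in the compound product is 'C(n, k) / n ^ k, which is
    nonnegative and at most 1 / k!.  Hence the entries of the difference between the
    n-th partial sum of the exponential series and the compound product are bounded
    by the same difference for the scalar entries_sum A, and both scalar sequences
    have the same limit. *)
Lemma cvg_mexp_compound d (A : 'M[R]_d) i j :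
  ((1 + n.+1%:R^-1 *: A) ^+ n.+1) i j @[n --> \oo] --> mexp A i j.
Proof.
set a := entries_sum A.
pose S n := \sum_(k < n.+2) k`!%:R^-1 * (A ^+ k) i j.
pose c n k : R := n.+1%:R ^- k * 'C(n.+1, k)%:R.
have c_le n k : c n k <= k`!%:R^-1.
  rewrite /c ler_pdivrMl ?exprn_gt0// ler_pdivlMr ?ltr0n ?fact_gt0//.
  by rewrite -natrM bin_ffact -natrX ler_nat ffact_le_expn.
have comp n : (1 + n.+1%:R^-1 *: A) ^+ n.+1 = \sum_(k < n.+2) c n k *: A ^+ k.
  rewrite exprDn_comm; last exact/commr_sym/commr1.
  apply: eq_bigr => k _.
  by rewrite expr1n mul1r exprZmx exprVn scalerMnl -mulr_natr.
have compR n : (1 + n.+1%:R^-1 * a) ^+ n.+1 = \sum_(k < n.+2) c n k * a ^+ k.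
  rewrite exprDn; apply: eq_bigr => k _.
  by rewrite expr1n mul1r exprMn exprVn -mulrnAl -mulr_natr.
have d0 : S n - ((1 + n.+1%:R^-1 *: A) ^+ n.+1) i j @[n --> \oo] --> 0.
  apply/norm_cvg0P.
  apply: (@squeeze_cvgr _ _ _ _ (fun=> 0)
    (fun n => \sum_(k < n.+2) k`!%:R^-1 * a ^+ k - (1 + n.+1%:R^-1 * a) ^+ n.+1)).
  - near=> n; rewrite normr_ge0/= comp compR summxE -!sumrB.
    apply: le_trans (ler_norm_sum _ _ _) _; apply: ler_sum => k _.
    rewrite mxE -!mulrBl normrM ger0_norm ?subr_ge0// ler_wpM2l ?subr_ge0//.
    exact: ler_expmx_entry.
  - exact: cvg_cst.
  - rewrite -[X in _ --> X](subrr (expR a)); apply: cvgB.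
      rewrite (_ : (fun n => _) = (fun n => series (exp_coeff a) (n + 2)%N)).
        by rewrite cvg_shiftn; exact: is_cvg_series_exp_coeff.
      apply/funext => n; rewrite /series/= addn2 big_mkord.
      by apply: eq_bigr => k _; rewrite /= mulrC.
    apply: cvg_compound.
      by rewrite -(mul0r a); apply: cvgMr_tmp; exact: cvg_harmonic.
    rewrite (_ : (fun n => _) = cst a); first exact: cvg_cst.
    by apply/funext => n; rewrite mulrA mulfV ?mul1r.
rewrite (_ : (fun n => _) =
    S \- (fun n => S n - ((1 + n.+1%:R^-1 *: A) ^+ n.+1) i j)).
  rewrite -[X in _ --> X]subr0; apply: cvgB => //.
  exact: cvg_mexp_partial.
by apply/funext => n /=; rewrite opprB [RHS]addrC subrK.
Unshelve. all: by end_near. Qed.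

(** The first-order expansion of the determinant at the identity: \det (n%:M + A) is
    the value at n of the characteristic polynomial of - A, whose two leading
    coefficients are 1 and \tr A. *)
Lemma cvg_det_perturbation d (A : 'M[R]_d) :
  n.+1%:R * (\det (1 + n.+1%:R^-1 *: A) - 1) @[n --> \oo] --> \tr A.
Proof.
case: d => [|d] in A *.
  rewrite [X in _ --> X](_ : _ = 0) ?/mxtrace ?big_ord0//.
  rewrite (_ : (fun n => _) = cst 0); first exact: cvg_cst.
  by apply/funext => n; rewrite det_mx00 subrr mulr0.
set p := char_poly (- A).
have pE n : n.+1%:R * (\det (1 + n.+1%:R^-1 *: A) - 1) =
    \sum_(k < d) p`_k * n.+1%:R^-1 ^+ (d - k) + \tr A.
  have n0 : n.+1%:R != 0 :> R by [].
  have -> : 1 + n.+1%:R^-1 *: A = n.+1%:R^-1 *: (n.+1%:R%:M + A).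
    by rewrite scalerDr scale_scalar_mx mulVf.
  rewrite detZ.
  have -> : \det (n.+1%:R%:M + A) = p.[n.+1%:R].
    rewrite -horner_evalE -det_map_mx; congr (\det _).
    apply/matrixP => i j; rewrite !mxE /= /horner_eval !hornerE/=.
    by case: (i == j); rewrite ?mulr1n ?mulr0n ?hornerE/= ?opprK.
  rewrite (@horner_coef_wide _ d.+2) ?size_char_poly// big_ord_recr/=.
  have -> : p`_d.+1 = 1.
    by have /monicP := char_poly_monic (- A); rewrite lead_coefE size_char_poly.
  rewrite big_ord_recr/=.
  have -> : p`_d = \tr A.
    by have /= -> := @char_poly_trace _ _ (- A) isT; rewrite raddfN opprK.
  set x : R := n.+1%:R in n0 *.
  have xK k : x^-1 ^+ k * x ^+ k = 1 by rewrite -exprMn mulVf ?expr1n.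
  rewrite mul1r [X in x * (X - 1)]mulrDr xK addrK exprS -mulrA mulVKf// mulrDr mulrCA xK mulr1.
  congr (_ + _); rewrite mulr_sumr; apply: eq_bigr => k _.
  have -> : x^-1 ^+ d = x^-1 ^+ (d - k) * x^-1 ^+ k.
    by rewrite -exprD subnK// ltnW.
  by rewrite mulrCA -mulrA xK mulr1.
rewrite -[X in _ --> X]add0r (_ : (fun n => _) = fun n =>
  \sum_(k < d) p`_k * n.+1%:R^-1 ^+ (d - k) + \tr A); last exact/funext.
apply: cvgD; last exact: cvg_cst.
rewrite -[X in _ --> X](@big1_eq _ _ +%R 'I_d (index_enum _) xpredT).
apply: cvg_big => [|k _]; first by move=> /= x; exact: add_continuous.
rewrite -[X in _ --> X](mulr0 p`_k); apply: cvgMl_tmp.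
rewrite -(prednK (_ : 0 < d - k)%N) ?subn_gt0//.
rewrite -[X in _ --> X](expr0n _ (d - k).-1.+1).
exact: (continuous_cvg _ (@exprn_continuous R (d - k).-1.+1 0) cvg_harmonic).
Qed.

(** The determinant is continuous and multiplicative, so \det (mexp A) is the limit of
    \det (1 + A / n) ^+ n, to which the scalar compound limit applies. *)
Lemma det_mexp d (A : 'M[R]_d) : \det (mexp A) = expR (\tr A).
Proof.
have /cvg_lim <- // : \det ((1 + n.+1%:R^-1 *: A) ^+ n.+1) @[n --> \oo] -->
    \det (mexp A) by apply: cvg_det => i j; exact: cvg_mexp_compound.
apply/cvg_lim => //; pose x n := \det (1 + n.+1%:R^-1 *: A) - 1.
have detX (B : 'M[R]_d) n : \det (B ^+ n) = \det B ^+ n.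
  by elim: n => [|n IHn]; rewrite ?det1// !exprS det_mulmx IHn.
rewrite (_ : (fun n => _) = fun n => (1 + x n) ^+ n.+1); last first.
  by apply/funext => n; rewrite detX /x [in RHS]addrC subrK.
apply: cvg_compound; last exact: cvg_det_perturbation.
rewrite (_ : x = fun n => n.+1%:R^-1 * (n.+1%:R * x n)); last first.
  by apply/funext => n; rewrite mulKf.
rewrite -[X in _ --> X](mul0r (\tr A)).
apply: cvgM; [exact: cvg_harmonic|exact: cvg_det_perturbation].
Qed.

End mexp.

(** * Linear change of variables for the Lebesgue measure *)

Definition affine {R : realType} (a b : R) (t : measurableTypeR R) :
  measurableTypeR R := a * t + b.

Section affine.
Context {R : realType}.
Variables (a b : R).

Lemma measurable_affine : measurable_fun setT (affine a b).
Proof.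
apply: (@measurable_funD _ _ _ _ (fun t : measurableTypeR R => a * t : R)
  (cst b)); last exact: measurable_cst.
exact: mulrl_measurable.
Qed.

(** By uniqueness of the Lebesgue measure it is enough to look at intervals, whose
    inverse images are intervals; for a < 0 the two ends, and hence the open and
    closed sides, are exchanged. *)
Lemma lebesgue_measure_affine (A : set (measurableTypeR R)) :
  a != 0 -> measurable A ->
  lebesgue_measure A =
  (`|a|%:E * lebesgue_measure (affine a b @^-1` A))%E.
Proof.
move=> a0 mA; apply: (@lebesgue_measure_unique R
  (mscale `|a|%:nng (pushforward lebesgue_measure (affine a b)))) => //.
  exact: measurable_affine.
move=> maff _ [[x y]] _ <-.
rewrite -[RHS]/(`|a|%:E * lebesgue_measure
  (affine a b @^-1` `]x, y]%classic))%E.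
have [a_gt0|a_le0] := ltP 0 a.
  rewrite (_ : _ @^-1` _ = `](x - b) / a, (y - b) / a]%classic); last first.
    apply/seteqP; split=> t /=; rewrite /affine !in_itv/=;
      by rewrite ltr_pdivrMr// ler_pdivlMr// (mulrC t) ltrBlDr lerBrDr.
  rewrite !lebesgue_measure_itv/= !lte_fin ltr_pM2r ?invr_gt0// ltrD2r.
  case: ifP => _; last by rewrite mule0.
  rewrite -!EFinD -EFinM gtr0_norm//; congr (_%:E).
  by field.
have a_lt0 : a < 0 by rewrite lt_neqAle a0.
rewrite (_ : _ @^-1` _ = `[(y - b) / a, (x - b) / a[%classic); last first.
  apply/seteqP; split=> t /=; rewrite /affine !in_itv/= andbC;
    by rewrite ltr_ndivlMr// ler_ndivrMr// (mulrC t) ltrBlDr lerBrDr.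
rewrite !lebesgue_measure_itv/= !lte_fin ltr_nM2r ?invr_lt0// ltrD2r.
case: ifP => _; last by rewrite mule0.
rewrite -!EFinD -EFinM ltr0_norm//; congr (_%:E).
by field.
Qed.

Lemma integral_affine (f : measurableTypeR R -> \bar R) : a != 0 ->
  measurable_fun setT f -> (forall t, 0 <= f t)%E ->
  (\int[lebesgue_measure]_t f (affine a b t) =
   (`|a|^-1)%R%:E * \int[lebesgue_measure]_t f t)%E.
Proof.
move=> a0 mf f0.
have maff := measurable_affine.
suff -> : (\int[lebesgue_measure]_t f t =
    `|a|%R%:E * \int[lebesgue_measure]_t f (affine a b t))%E.
  by rewrite muleA -EFinM mulVf ?normr_eq0// mul1e.
pose k := NngNum (normr_ge0 a).
rewrite (eq_measure_integral
  (mscale k (pushforward lebesgue_measure (affine a b)))) => [|A mA _].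
  by rewrite ge0_integral_mscale//= ge0_integral_pushforward.
exact: lebesgue_measure_affine.
Qed.

End affine.

Section lebesgue_linear.
Context {R : realType}.

Lemma consVD d (p q : measurableTypeR R * 'cV[R]_d) :
  consV p + consV q = consV (p.1 + q.1 : R, p.2 + q.2).
Proof. by rewrite /consV (@add_col_mx R 1 d 1) -raddfD. Qed.

Lemma measurable_linear d e (A : 'M[R]_(e, d)) :
  measurable_fun setT (mulmx A : 'cV[R]_d -> 'cV[R]_e).
Proof.
apply: measurable_fun_coordP => i.
under eq_fun do rewrite mxE.
apply: measurable_sum => k.
apply: (@measurable_funM _ _ _ _ (cst (A i k)) (fun x : 'cV[R]_d => x k 0)).
  exact: measurable_cst.
exact: measurable_coord.
Qed.

Lemma measurable_comp_linear d (A : 'M[R]_d) (f : 'cV[R]_d -> \bar R) :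
  measurable_fun setT f -> measurable_fun setT (fun x : 'cV[R]_d => f (A *m x)).
Proof. by move=> mf; apply: (measurableT_comp mf); exact: measurable_linear. Qed.

Lemma measurable_addr_cV d (h : 'cV[R]_d) :
  measurable_fun setT (fun x : 'cV[R]_d => x + h).
Proof.
apply: measurable_fun_coordP => i.
under eq_fun do rewrite mxE.
by apply: measurable_funD; [exact: measurable_coord|exact: measurable_cst].
Qed.

Section cons_integral.
Variables (d : nat) (f : 'cV[R]_d.+1 -> \bar R).
Hypotheses (mf : measurable_fun setT f) (f0 : forall x, (0 <= f x)%E).

Lemma measurable_comp_consV : measurable_fun setT (f \o @consV R d).
Proof. by apply: measurableT_comp => //; exact: measurable_consV. Qed.

Lemma integral_cons_tail :
  (\int[lebesgue_cV d.+1]_x f x =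
   \int[lebesgue_measure]_t \int[lebesgue_cV d]_y f (consV (t, y)))%E.
Proof.
rewrite /= ge0_integral_pushforward//.
rewrite preimage_setT (fubini_tonelli1 (f \o @consV R d))//.
  exact: measurable_comp_consV.
by move=> p; exact: f0.
Qed.

Lemma integral_cons_head :
  (\int[lebesgue_cV d.+1]_x f x =
   \int[lebesgue_cV d]_y \int[lebesgue_measure]_t f (consV (t, y)))%E.
Proof.
rewrite /= ge0_integral_pushforward//.
rewrite preimage_setT (fubini_tonelli2 (f \o @consV R d))//.
  exact: measurable_comp_consV.
by move=> p; exact: f0.
Qed.

Lemma measurable_cons_tail t :
  measurable_fun setT (fun y : 'cV[R]_d => f (consV (t, y))).
Proof.
exact: (measurableT_comp measurable_comp_consV (@pair1_measurable _ _
  (measurableTypeR R) 'cV[R]_d t)).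
Qed.

Lemma measurable_cons_head y :
  measurable_fun setT (fun t : measurableTypeR R => f (consV (t, y))).
Proof.
exact: (measurableT_comp measurable_comp_consV (@pair2_measurable _ _
  (measurableTypeR R) 'cV[R]_d y)).
Qed.

Lemma measurable_integral_tail :
  measurable_fun setT (fun t => \int[lebesgue_cV d]_y f (consV (t, y)))%E.
Proof.
apply: (measurable_fun_fubini_tonelli_F (f \o @consV R d)).
  exact: measurable_comp_consV.
by move=> p; exact: f0.
Qed.

End cons_integral.

(** By induction on d through the decomposition of vectors into head and tail: the
    tail is translated by induction, the head by the one-dimensional formula. *)
Lemma integral_translate d (h : 'cV[R]_d) (f : 'cV[R]_d -> \bar R) :
  measurable_fun setT f -> (forall x, 0 <= f x)%E ->
  (\int[lebesgue_cV d]_x f (x + h)%R = \int[lebesgue_cV d]_x f x)%E.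
Proof.
elim: d => [|d IHd] in h f * => mf f0.
  by congr integral; apply/funext => x; congr f; apply/matrixP => -[].
have mfh : measurable_fun setT (fun x : 'cV[R]_d.+1 => f (x + h)).
  by apply: (measurableT_comp mf); exact: measurable_addr_cV.
rewrite (integral_cons_tail mfh (fun=> f0 _)) (integral_cons_tail mf f0).
rewrite -(unconsVK h).
set h0 := (unconsV h).1; set h' := (unconsV h).2.
transitivity (\int[lebesgue_measure]_t
    \int[lebesgue_cV d]_y f (consV (affine 1 h0 t, y)))%E.
  apply: eq_integral => t _.
  rewrite -[RHS](IHd h'); last 2 first.
  - exact: measurable_cons_tail.
  - by move=> y.
  by apply: eq_integral => y _; rewrite consVD /affine mul1r.
rewrite (integral_affine _ (f := fun t =>
  \int[lebesgue_cV d]_y f (consV (t, y)))%E) ?oner_neq0//.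
- by rewrite normr1 invr1 mul1e.
- exact: measurable_integral_tail.
- by move=> t; exact: integral_ge0.
Qed.

(** The change of variables formula for the linear map A, as a property that is closed
    under products; it is established for shears and diagonal blocks, which generate
    the invertible matrices. *)
Definition lebesgue_scaling d (A : 'M[R]_d) := forall f : 'cV[R]_d -> \bar R,
  measurable_fun setT f -> (forall x, 0 <= f x)%E ->
  (\int[lebesgue_cV d]_x f (A *m x)%R =
   (`|\det A|^-1)%R%:E * \int[lebesgue_cV d]_x f x)%E.

Lemma lebesgue_scalingM d (A B : 'M[R]_d) :
  lebesgue_scaling A -> lebesgue_scaling B -> lebesgue_scaling (A *m B).
Proof.
move=> hA hB f mf f0.
under eq_integral do rewrite -mulmxA.
rewrite (hB (fun x => f (A *m x)) (measurable_comp_linear A mf))//.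
by rewrite hA// muleA -EFinM det_mulmx normrM invfM mulrC.
Qed.

Lemma block_consV d (a : 'M[R]_1) (u : 'rV[R]_d) (v : 'cV[R]_d) (B : 'M[R]_d)
    t y :
  (block_mx a u v B : 'M[R]_d.+1) *m consV (t, y) =
  consV (a 0 0 * t + (u *m y) 0 0 : R, t *: v + B *m y).
Proof.
rewrite /consV /= (@mul_block_col _ 1 d 1 d).
congr (@col_mx R 1 d 1 _ _).
  apply/matrixP => i j; rewrite !ord1 !mxE big_ord1 !mxE eqxx !mulr1n.
  by congr (_ + _).
by rewrite -mul_mx_scalar.
Qed.

(** With the head t fixed, the map translates the tail by t *: v. *)
Lemma scaling_lower_shear d (v : 'cV[R]_d) :
  lebesgue_scaling (block_mx 1 0 v 1%:M : 'M[R]_d.+1).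
Proof.
move=> f mf f0.
rewrite (@det_lblock _ 1 d) !det1 mulr1 normr1 invr1 mul1e.
rewrite (integral_cons_tail (measurable_comp_linear _ mf) (fun=> f0 _)).
rewrite (integral_cons_tail mf f0).
apply: eq_integral => t _.
rewrite -[RHS](integral_translate (t *: v)); last 2 first.
- exact: measurable_cons_tail.
- by move=> y.
apply: eq_integral => y _.
by rewrite block_consV mul1mx mul0mx !mxE addr0 mul1r addrC.
Qed.

(** With the tail y fixed, the map translates the head by u *m y. *)
Lemma scaling_upper_shear d (u : 'rV[R]_d) :
  lebesgue_scaling (block_mx 1 u 0 1%:M : 'M[R]_d.+1).
Proof.
move=> f mf f0.
rewrite (@det_ublock _ 1 d) !det1 mulr1 normr1 invr1 mul1e.
rewrite (integral_cons_head (measurable_comp_linear _ mf) (fun=> f0 _)).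
rewrite (integral_cons_head mf f0).
apply: eq_integral => y _.
transitivity (\int[lebesgue_measure]_t
  f (consV (affine 1 ((u *m y) 0 0)%R t, y)))%E.
  apply: eq_integral => t _.
  by rewrite block_consV mul1mx scaler0 add0r !mxE.
rewrite (integral_affine _ (f := fun t => f (consV (t, y)))) ?oner_neq0//.
- by rewrite normr1 invr1 mul1e.
- exact: measurable_cons_head.
Qed.

Lemma scaling_block_diag d (a : R) (B : 'M[R]_d) : a != 0 ->
  lebesgue_scaling B ->
  lebesgue_scaling (block_mx (a%:M : 'M[R]_1) 0 0 B : 'M[R]_d.+1).
Proof.
move=> a0 hB f mf f0.
rewrite (@det_ublock _ 1 d) det_scalar1.
rewrite (integral_cons_tail (measurable_comp_linear _ mf) (fun=> f0 _)).
rewrite (integral_cons_tail mf f0).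
pose G t := (\int[lebesgue_cV d]_y f (consV (t, y)))%E.
have mG : measurable_fun setT G := measurable_integral_tail mf f0.
have G0 t : (0 <= G t)%E by exact: integral_ge0.
transitivity (\int[lebesgue_measure]_t ((`|\det B|^-1)%R%:E *
  G (affine a 0 t)))%E.
  apply: eq_integral => t _; rewrite /G -hB//; last exact: measurable_cons_tail.
  apply: eq_integral => y _.
  by rewrite block_consV mul0mx scaler0 add0r !mxE eqxx mulr1n.
transitivity ((`|\det B|^-1)%R%:E *
  \int[lebesgue_measure]_t G (affine a 0 t))%E.
  apply: (@ge0_integralZl_EFin _ _ _ lebesgue_measure _ measurableT
    (G \o affine a 0)).
  - by move=> t _; exact: G0.
  - by apply: (measurableT_comp mG); exact: measurable_affine.
  - by rewrite invr_ge0.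
rewrite (integral_affine _ a0 mG G0) muleA -EFinM.
by rewrite normrM invfM mulrC.
Qed.

(** Gaussian elimination with the corner entry as pivot writes A as a lower shear, a
    block-diagonal matrix and an upper shear; the lower block is the Schur
    complement, which is invertible because A is. *)
Lemma lebesgue_scaling_pivot d (A : 'M[R]_(1 + d)) :
  (forall B : 'M[R]_d, B \in unitmx -> lebesgue_scaling B) ->
  A \in unitmx -> A 0 0 != 0 -> lebesgue_scaling (A : 'M[R]_d.+1).
Proof.
move=> IHd uA a0; set a := A 0 0 in a0.
pose u := a^-1 *: ursubmx A; pose v := a^-1 *: dlsubmx A.
pose S := drsubmx A - dlsubmx A *m u.
have eA : A = block_mx 1 0 v 1%:M *m
    (block_mx (a%:M : 'M[R]_1) 0 0 S *m block_mx 1 u 0 1%:M).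
  have ea : ulsubmx A = a%:M.
    by apply/matrixP => i j; rewrite !ord1 !mxE eqxx mulr1n; congr (A _ _);
      exact/val_inj.
  rewrite !mulmx_block !mul0mx !mulmx0 !mul1mx !mulmx1 !addr0 !add0r.
  rewrite -[LHS]submxK ea mul_mx_scalar mul_scalar_mx !scalerKV//.
  by rewrite /S /v /u -scalemxAl -scalemxAr addrC subrK.
have uS : S \in unitmx.
  move: uA; rewrite eA !unitmxE !det_mulmx det_lblock !det_ublock.
  by rewrite !det1 !mul1r mulr1 det_scalar1 unitrM => /andP[].
rewrite eA; apply: (lebesgue_scalingM (scaling_lower_shear _)).
apply: (lebesgue_scalingM _ (scaling_upper_shear _)).
exact/scaling_block_diag/IHd.
Qed.

Let lshift_ord0 d (j : 'I_1) : @lshift 1 d j = (0 : 'I_d.+1).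
Proof. by apply/val_inj; rewrite /= ord1. Qed.

(** No row exchange is needed when the corner entry vanishes: some other entry of the
    first column does not, and adding its row to the first one is an upper shear. *)
Lemma lebesgue_scaling_unit d (A : 'M[R]_d) :
  A \in unitmx -> lebesgue_scaling A.
Proof.
elim: d => [|d IHd] in A *.
  move=> _ f mf f0; rewrite det_mx00 normr1 invr1 mul1e.
  by congr integral; apply/funext => x; congr f; apply/matrixP => -[].
move=> uA; have [A00|A00] := eqVneq (A 0 0) 0; last exact: lebesgue_scaling_pivot.
have [i Ai0] : exists i : 'I_d, A (rshift 1 i) 0 != 0.
  apply/existsP; apply: contraLR uA => /existsPn A0.
  rewrite unitmxE (expand_det_col _ 0) big1 ?unitr0// => k _.
  have [j|j] := @split_ordP 1 d k; move=> ->.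
    by rewrite lshift_ord0 A00 mul0r.
  by move/(_ j) : A0; rewrite negbK => /eqP ->; rewrite mul0r.
(* S e adds row i of the lower block to the first row; S (- e) undoes it. *)
pose e : 'rV[R]_d := delta_mx 0 i.
pose S (u : 'rV[R]_d) : 'M[R]_(1 + d) := block_mx 1 u 0 1%:M.
have SK : S (- e) *m S e = 1%:M.
  rewrite /S mulmx_block !mul1mx !mulmx0 !mul0mx !mulmx1.
  by rewrite !addr0 add0r subrr -scalar_mx_block.
rewrite -[A]mul1mx -SK -mulmxA.
apply: (lebesgue_scalingM (scaling_upper_shear _)).
apply: lebesgue_scaling_pivot => //.
  by rewrite unitmx_mul uA andbT unitmxE (@det_ublock _ 1 d) !det1 mulr1 unitr1.
rewrite (_ : (S e *m A) 0 0 = A (rshift 1 i) 0)//.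
rewrite -[in LHS](@lshift_ord0 d 0) mxE (@big_split_ord _ _ _ 1 d) big_ord1 /=.
rewrite lshift_ord0 A00 mulr0 add0r (bigD1 i)//= big1 ?addr0 => [|j ji].
  by rewrite -[in X in S _ X](@lshift_ord0 d 0) (@block_mxEur _ 1 d) mxE !eqxx mul1r.
rewrite -[in X in S _ X](@lshift_ord0 d 0) (@block_mxEur _ 1 d) mxE.
by rewrite (negPf ji) andbF mul0r.
Qed.

End lebesgue_linear.

(** * Cosine expectations determine the law of a random vector *)

Section bounded_expectation.
Context {R : realType} {d : measure_display} {T : measurableType d}.
Variable P : probability T R.

Lemma bounded_integrable (f : T -> R) (M : R) :
  measurable_fun setT f -> (forall x, `|f x| <= M) ->
  P.-integrable setT (EFin \o f).
Proof.
move=> mf fM; apply: measurable_bounded_integrable => //.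
  by rewrite (le_lt_trans (probability_le1 _ _))// ltry.
by exists M; split; [exact: num_real|move=> N /ltW MN x _ /=; exact: le_trans MN].
Qed.

Lemma bounded_cvg_Rintegral (f_ : nat -> T -> R) (f : T -> R) (M : R) :
  (forall k, measurable_fun setT (f_ k)) ->
  (forall k x, `|f_ k x| <= M) ->
  (forall x, f_ k x @[k --> \oo] --> f x) ->
  \int[P]_x f_ k x @[k --> \oo] --> \int[P]_x f x.
Proof.
move=> mf_ f_M f_f.
have mf : measurable_fun setT f.
  by apply: (measurable_fun_cvg mf_) => x _; exact: f_f.
have icst : P.-integrable setT (EFin \o cst M).
  exact: finite_measure_integrable_cst.
have [intf _ h] : [/\ P.-integrable setT (EFin \o f),
    [sequence \int[P]_x `|(f_ k x)%:E - (f x)%:E|]_k @ \oo --> 0 &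
    [sequence \int[P]_x (f_ k x)%:E]_k @ \oo --> \int[P]_x (f x)%:E]%E.
  apply: (@dominated_convergence _ _ _ _ _ _ _ _ (EFin \o cst M)) => //.
  - by move=> k; exact/measurable_EFinP.
  - exact/measurable_EFinP.
  - by apply: aeW => x _; apply: cvg_EFin; [exact: nearW|exact: f_f].
  - by apply: aeW => x k _ /=; rewrite lee_fin.
by apply: fine_cvg; rewrite fineK//; exact: integrable_fin_num intf.
Qed.

End bounded_expectation.

Lemma measurable_fun_cos (R : realType) : measurable_fun setT (@cos R).
Proof. by apply: continuous_measurable_fun => x; exact: continuous_cos. Qed.

Section sign_iteration.
Context {R : realType}.
Implicit Types s : R.

(** On [-1, 1] the fixed points of this cubic are -1, 0 and 1, and its iterates push
    every point to its sign while staying in [-1, 1].  So the sign function is a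
    bounded pointwise limit of explicit polynomials. *)
Definition sharpen s : R := (3 * s - s ^+ 3) / 2.

Lemma sharpen_itv s : 0 < s <= 1 -> s <= sharpen s <= 1.
Proof.
move=> /andP[s0 s1]; have h1 : 0 <= s * (1 - s) * (1 + s).
  by rewrite !mulr_ge0 ?subr_ge0 ?addr_ge0 ?(ltW s0).
have h2 : 0 <= (1 - s) ^+ 2 * (s + 2) by rewrite mulr_ge0 ?sqr_ge0 ?addr_ge0 ?(ltW s0).
by rewrite /sharpen; apply/andP; split; lra.
Qed.

Lemma sharpenN s : sharpen (- s) = - sharpen s.
Proof. by rewrite /sharpen; field. Qed.

Lemma iter_sharpenN k s : iter k sharpen (- s) = - iter k sharpen s.
Proof. by elim: k => //= k ->; rewrite sharpenN. Qed.

Lemma iter_sharpen0 k : iter k sharpen 0 = 0.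
Proof. by elim: k => //= k ->; rewrite /sharpen; field. Qed.

Lemma iter_sharpen_itv k s : 0 < s <= 1 -> 0 < iter k sharpen s <= 1.
Proof.
move=> s01; elim: k => //= k IHk; have /andP[i0 _] := IHk.
by have /andP[i1 ->] := sharpen_itv IHk; rewrite (lt_le_trans i0).
Qed.

Lemma continuous_sharpen : continuous sharpen.
Proof.
move=> x; rewrite /sharpen; apply: cvgMr_tmp; apply: cvgB.
  by apply: cvgMl_tmp; exact: cvg_id.
exact: exprn_continuous.
Qed.

(** The iterates increase and are bounded by 1; the limit is a positive fixed point of
    the cubic, hence 1. *)
Lemma cvg_sharpen_pos s : 0 < s <= 1 -> iter k sharpen s @[k --> \oo] --> (1 : R).
Proof.
move=> s01; pose u k := iter k sharpen s.
have u01 k : 0 < u k <= 1 by exact: iter_sharpen_itv.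
have ndu : nondecreasing_seq u.
  apply/nondecreasing_seqP => k /=.
  by have /andP[] := sharpen_itv (u01 k).
have cu : cvgn u.
  apply: nondecreasing_is_cvgn => //.
  by exists 1 => _ [k _ <-]; have /andP[] := u01 k.
have su : s <= limn u by exact: (nondecreasing_cvgn_le ndu cu 0).
have ul : limn u = sharpen (limn u).
  have c1 : sharpen (u n) @[n --> \oo] --> sharpen (limn u).
    apply: continuous_cvg; [exact: continuous_sharpen|exact: cu].
  have c2 : [sequence u n.+1]_n @ \oo --> limn u by rewrite cvg_shiftS.
  by apply: (cvg_unique _ c2 c1).
suff -> : 1 = limn u by [].
have /andP[s0 _] := s01; have l0 := lt_le_trans s0 su.
apply/esym/eqP; rewrite -subr_eq0.
have : limn u * ((limn u - 1) * (limn u + 1)) = 0.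
  by move: ul; rewrite /sharpen; lra.
by move/eqP; rewrite !mulf_eq0 (gt_eqF l0)/= (gt_eqF (addr_gt0 l0 ltr01)) orbF.
Qed.

Lemma iter_sharpen_sg s : `|s| <= 1 -> iter k sharpen s @[k --> \oo] --> (Num.sg s : R).
Proof.
have [s0|s0|->] := ltgtP s 0 => s1.
- rewrite ltr0_sg// -[s]opprK; under eq_cvg do rewrite iter_sharpenN.
  apply: cvgN; apply: cvg_sharpen_pos.
  by rewrite oppr_gt0 s0/=; move: s1; rewrite ltr0_norm.
- rewrite gtr0_sg//; apply: cvg_sharpen_pos.
  by rewrite s0 (le_trans (ler_norm _)).
- by rewrite sgr0; under eq_cvg do rewrite iter_sharpen0; exact: cvg_cst.
Qed.

Lemma iter_sharpen_le1 k s : `|s| <= 1 -> `|iter k sharpen s| <= 1.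
Proof.
have [s0|s0|->] := ltgtP s 0 => s1.
- rewrite -[s]opprK iter_sharpenN normrN.
  have /(iter_sharpen_itv k)/andP[i0 i1] : 0 < - s <= 1.
    by rewrite oppr_gt0 s0/=; move: s1; rewrite ltr0_norm.
  by rewrite gtr0_norm.
- have /(iter_sharpen_itv k)/andP[i0 i1] : 0 < s <= 1.
    by rewrite s0 (le_trans (ler_norm _)).
  by rewrite gtr0_norm.
- by rewrite iter_sharpen0 normr0.
Qed.

(** The quadratic that sends -1, 0, 1 to 0, 0, 1: applied to a sign it gives the
    indicator of the positive reals. *)
Definition sign_indicator s : R := (s ^+ 2 + s) / 2.

Lemma continuous_sign_indicator : continuous sign_indicator.
Proof.
move=> x; rewrite /sign_indicator; apply: cvgMr_tmp; apply: cvgD.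
  exact: exprn_continuous.
exact: cvg_id.
Qed.

Lemma sign_indicator_sg s : sign_indicator (Num.sg s) = (0 < s)%R%:R.
Proof.
rewrite /sign_indicator; have [s0|s0|->] := ltgtP s 0.
- by rewrite ltr0_sg//=; field.
- by rewrite gtr0_sg//=; field.
- by rewrite sgr0/=; field.
Qed.

Lemma sign_indicator_le1 s : `|s| <= 1 -> `|sign_indicator s| <= 1.
Proof. by rewrite !ler_norml /sign_indicator => /andP[? ?]; apply/andP; split; nra. Qed.

End sign_iteration.

Section trigonometric_polynomials.
Context {R : realType} {n : nat}.
Implicit Types (F G : ('I_n -> R) -> R) (x t : 'I_n -> R).

(** The linear span of the cosines of affine forms.  The phase b gives the constants
    and the sines, and the span is closed under products. *)
Inductive trig_poly : (('I_n -> R) -> R) -> Prop :=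
| trig_cos c t b : trig_poly (fun x => c * cos (\sum_i t i * x i + b))
| trig_add F G : trig_poly F -> trig_poly G -> trig_poly (fun x => F x + G x).

Lemma trig_poly_cst c : trig_poly (fun=> c).
Proof.
rewrite (_ : (fun=> c) = fun x => c * cos (\sum_i 0 * x i + 0)).
  exact: (trig_cos c (fun=> 0)).
apply/funext => x; rewrite big1 ?addr0 ?cos0 ?mulr1// => i _.
by rewrite mul0r.
Qed.

(** The product of two cosines is half the sum of the cosines of the sum and of the
    difference of their arguments. *)
Lemma trig_poly_mul F G :
  trig_poly F -> trig_poly G -> trig_poly (fun x => F x * G x).
Proof.
move=> tF tG; elim: tF => [c t b|F1 F2 _ ih1 _ ih2]; last first.
  by under eq_fun do rewrite mulrDl; exact: trig_add.
elim: tG => [c' t' b'|G1 G2 _ ih1 _ ih2]; last first.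
  by under eq_fun do rewrite mulrDr; exact: trig_add.
rewrite (_ : (fun _ => _) = fun x =>
    c * c' / 2 * cos (\sum_i (t i + t' i) * x i + (b + b')) +
    c * c' / 2 * cos (\sum_i (t i - t' i) * x i + (b - b'))).
  exact: (trig_add (trig_cos _ (fun i => t i + t' i) _)
    (trig_cos _ (fun i => t i - t' i) _)).
apply/funext => x.
set u := \sum_i t i * x i + b; set v := \sum_i t' i * x i + b'.
have -> : \sum_i (t i + t' i) * x i + (b + b') = u + v.
  under eq_bigr do rewrite mulrDl.
  by rewrite big_split/= addrACA.
have -> : \sum_i (t i - t' i) * x i + (b - b') = u - v.
  under eq_bigr do rewrite mulrBl.
  by rewrite sumrB /u /v; ring.
by clearbody u v; rewrite cosD cosB; field.
Qed.

Lemma trig_poly_exp F k : trig_poly F -> trig_poly (fun x => F x ^+ k).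
Proof.
move=> tF; elim: k => [|k IHk].
  by under eq_fun do rewrite expr0; exact: trig_poly_cst.
by under eq_fun do rewrite exprS; exact: trig_poly_mul.
Qed.

Lemma trig_poly_prod (F : 'I_n -> ('I_n -> R) -> R) (s : seq 'I_n) :
  (forall i, trig_poly (F i)) -> trig_poly (fun x => \prod_(i <- s) F i x).
Proof.
move=> tF; elim: s => [|i s IHs].
  by under eq_fun do rewrite big_nil; exact: trig_poly_cst.
by under eq_fun do rewrite big_cons; exact: trig_poly_mul.
Qed.

Lemma trig_poly_sharpen F k :
  trig_poly F -> trig_poly (fun x => iter k sharpen (F x)).
Proof.
move=> tF; elim: k => //= k IHk.
rewrite (_ : (fun _ => _) = fun x => 3 / 2 * iter k sharpen (F x) +
    - 2^-1 * iter k sharpen (F x) ^+ 3).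
  apply: trig_add; apply: trig_poly_mul; try exact: trig_poly_cst => //.
    exact: IHk.
  exact: trig_poly_exp.
by apply/funext => x; rewrite {1}/sharpen; field.
Qed.

Lemma trig_poly_sign_indicator F :
  trig_poly F -> trig_poly (fun x => sign_indicator (F x)).
Proof.
move=> tF; rewrite /sign_indicator.
apply: trig_poly_mul; last exact: trig_poly_cst.
by apply: trig_add => //; exact: trig_poly_exp.
Qed.

(** A sine is a cosine shifted by a quarter of a period. *)
Lemma trig_poly_sin_coord i (a L : R) :
  trig_poly (fun x => sin ((x i - a) / L)).
Proof.
rewrite (_ : (fun _ => _) = fun x =>
    1 * cos (\sum_j (if j == i then L^-1 else 0) * x j + (- a / L - pi / 2))).
  exact: (trig_cos 1 (fun j => if j == i then L^-1 else 0)).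
apply/funext => x; rewrite (bigD1 i)//= eqxx big1 => [|j /negPf ->]; last first.
  by rewrite mul0r.
rewrite mul1r addr0 addrA (mulrC L^-1) -mulrDl.
by rewrite cosB cos_pihalf sin_pihalf mulr0 mulr1 add0r mulrC.
Qed.

End trigonometric_polynomials.

Section cosine_uniqueness.
Context {R : realType} {d : measure_display} {Omega : measurableType d}.
Variables (P : probability Omega R) (n : nat).
Implicit Types U V : 'I_n -> Omega -> R.

Lemma trig_poly_measurable (F : ('I_n -> R) -> R) U : trig_poly F ->
  (forall i, measurable_fun setT (U i)) ->
  measurable_fun setT (fun w => F (U ^~ w)).
Proof.
move=> + mU; elim=> [c t b|F1 F2 _ ih1 _ ih2]; last exact: measurable_funD.
apply: measurable_funM; first exact: measurable_cst.
apply: (measurableT_comp (@measurable_fun_cos R)).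
apply: measurable_funD; last exact: measurable_cst.
apply: measurable_sum => i.
by apply: measurable_funM; [exact: measurable_cst|exact: mU].
Qed.

Lemma trig_poly_bounded (F : ('I_n -> R) -> R) : trig_poly F ->
  exists M, forall x, `|F x| <= M.
Proof.
elim=> [c t b|F1 F2 _ [M1 F1M] _ [M2 F2M]].
  exists `|c| => x; rewrite normrM ler_piMr// ler_norml.
  by rewrite cos_geN1 cos_le1.
exists (M1 + M2) => x; rewrite (le_trans (ler_normD _ _))//.
exact: lerD.
Qed.

Variables U V : 'I_n -> Omega -> R.
Hypothesis mU : forall i, measurable_fun setT (U i).
Hypothesis mV : forall i, measurable_fun setT (V i).
Hypothesis cosUV : forall (t : 'I_n -> R) b,
  \int[P]_w cos (\sum_i t i * U i w + b) =
  \int[P]_w cos (\sum_i t i * V i w + b).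

Lemma expectation_trig_poly (F : ('I_n -> R) -> R) : trig_poly F ->
  \int[P]_w F (U ^~ w) = \int[P]_w F (V ^~ w).
Proof.
have mt W c (t : 'I_n -> R) b : (forall i, measurable_fun setT (W i)) ->
    P.-integrable setT (EFin \o (fun w => cos (\sum_i t i * W i w + b) : R)).
  move=> mW; apply: (@bounded_integrable _ _ _ _ _ 1) => [|w].
    have := trig_poly_measurable (trig_cos 1 t b) mW.
    by under eq_fun do rewrite mul1r.
  by rewrite ler_norml cos_geN1 cos_le1.
elim=> [c t b|F1 F2 t1 ih1 t2 ih2].
  by rewrite !RintegralZl// ?cosUV//; exact: mt.
have [M1 F1M] := trig_poly_bounded t1; have [M2 F2M] := trig_poly_bounded t2.
rewrite !RintegralD//; [by rewrite ih1 ih2|..].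
all: by apply: bounded_integrable => //; exact: trig_poly_measurable.
Qed.

Lemma expectation_bounded_limit (F_ : nat -> ('I_n -> R) -> R)
    (F : ('I_n -> R) -> R) :
  (forall k, measurable_fun setT (fun w => F_ k (U ^~ w))) ->
  (forall k, measurable_fun setT (fun w => F_ k (V ^~ w))) ->
  (forall k x, `|F_ k x| <= 1) -> (forall x, F_ k x @[k --> \oo] --> F x) ->
  (forall k, \int[P]_w F_ k (U ^~ w) = \int[P]_w F_ k (V ^~ w)) ->
  \int[P]_w F (U ^~ w) = \int[P]_w F (V ^~ w).
Proof.
move=> mFU mFV F1 FF eF.
have cU := @bounded_cvg_Rintegral _ _ _ P _ _ _ mFU (fun k w => F1 k _)
  (fun w => FF (U ^~ w)).
have cV := @bounded_cvg_Rintegral _ _ _ P _ _ _ mFV (fun k w => F1 k _)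
  (fun w => FF (V ^~ w)).
rewrite -(funext eF : (fun k => _) = _) in cV.
exact: (cvg_unique _ cU cV).
Qed.

(** Bounds are optional so that the whole space is a quadrant and a single constraint
    x i > r is one too: quadrants then form a pi-system that covers and generates. *)
Definition quadrant (a : 'I_n -> option R) : ('I_n -> R) -> bool :=
  fun x => [forall i, if a i is Some r then r < x i else true].

(** The indicator of x i > r is the limit, as L grows, of the indicator of
    sin ((x i - r) / L) > 0, which is itself a limit of polynomials in that sine by
    iterated sharpening.  The products over i of these approximations are bounded by 1
    and are trigonometric polynomials, so bounded convergence, first in the number of
    iterations and then in L, carries the equality of expectations to the quadrant. *)
Lemma expectation_quadrant (a : 'I_n -> option R) :
  \int[P]_w (quadrant a (U ^~ w))%:R = \int[P]_w (quadrant a (V ^~ w))%:R.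
Proof.
pose G L k (x : 'I_n -> R) i := if a i is Some r then
  sign_indicator (iter k sharpen (sin ((x i - r) / L))) else 1.
have tG L k : trig_poly (fun x => \prod_i G L k x i).
  apply: trig_poly_prod => i; rewrite /G; case: (a i) => [r|].
    exact/trig_poly_sign_indicator/trig_poly_sharpen/trig_poly_sin_coord.
  exact: trig_poly_cst.
pose G' L (x : 'I_n -> R) i := if a i is Some r then
  sign_indicator (Num.sg (sin ((x i - r) / L))) else 1.
have sin1 (y : R) : `|sin y| <= 1 by rewrite ler_norml sin_geN1 sin_le1.
have sg1 (y : R) : `|Num.sg y| <= 1 by rewrite normr_sg lern1 leq_b1.
have G'1 L x i : `|G' L x i| <= 1.
  by rewrite /G'; case: (a i) => [r|]; rewrite ?normr1// sign_indicator_le1.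
have G1 L k x i : `|G L k x i| <= 1.
  rewrite /G; case: (a i) => [r|]; rewrite ?normr1//.
  exact/sign_indicator_le1/iter_sharpen_le1.
have GG' L x : \prod_i G L k x i @[k --> \oo] --> \prod_i G' L x i.
  apply: cvg_big => [|i _]; first by move=> /= y; exact: mul_continuous.
  rewrite /G /G'; case: (a i) => [r|]; last exact: cvg_cst.
  apply: continuous_cvg; first exact: continuous_sign_indicator.
  exact: iter_sharpen_sg.
have G'q x : \prod_i G' n.+1%:R x i @[n --> \oo] --> ((quadrant a x)%:R : R).
  rewrite /quadrant -(big_andE xpredT) (big_morph (fun b : bool => b%:R : R)
    (id1 := 1) (op1 := *%R)) => [| |] //; last by case=> -[]; rewrite ?mulr1 ?mulr0.
  apply: cvg_big => [|i _]; first by move=> /= y; exact: mul_continuous.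
  rewrite /G'; case: (a i) => [r|]; last exact: cvg_cst.
  apply: cvg_near_cst; near=> m; rewrite sign_indicator_sg.
  (* Once m.+1 exceeds |x i - r| / pi, the argument of the sine lies in ]-pi, pi[ and
     the sine has the sign of x i - r. *)
  have mpi : `|x i - r| / m.+1%:R < pi.
    rewrite ltr_pdivrMr// mulrC -ltr_pdivrMr ?pi_gt0//.
    apply: (@lt_trans _ _ m%:R); last by rewrite ltr_nat.
    by near: m; exact: nbhs_infty_gtr.
  have m0 : 0 < m.+1%:R^-1 :> R by rewrite invr_gt0.
  have [xr|xr|->] := ltgtP (x i) r; last by rewrite subrr mul0r sin0 ltxx.
  - rewrite (_ : (0 < sin _) = false)//; apply/negbTE; rewrite -leNgt ltW//.
    rewrite -[x i - r]opprB mulNr sinN oppr_lt0 sin_gt0_pi// pmulr_lgt0// subr_gt0.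
    by rewrite xr/=; move: mpi; rewrite distrC gtr0_norm// subr_gt0.
  - rewrite sin_gt0_pi// pmulr_lgt0// subr_gt0 xr/=.
    by move: mpi; rewrite gtr0_norm// subr_gt0.
have prod1 (f : 'I_n -> R) : (forall i, `|f i| <= 1) -> `|\prod_i f i| <= 1.
  by move=> f1; rewrite normr_prod; apply: prodr_ile1 => i _; rewrite normr_ge0/=.
apply: (expectation_bounded_limit
  (F_ := fun m x => \prod_i G' m.+1%:R x i)
  (F := fun x => (quadrant a x)%:R)) => //.
- move=> m; apply: (measurable_fun_cvg (h := fun k w => \prod_i G m.+1%:R k (U ^~ w) i)).
    by move=> k; exact: (trig_poly_measurable (tG _ _) mU).
  by move=> w _; exact: GG'.
- move=> m; apply: (measurable_fun_cvg (h := fun k w => \prod_i G m.+1%:R k (V ^~ w) i)).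
    by move=> k; exact: (trig_poly_measurable (tG _ _) mV).
  by move=> w _; exact: GG'.
- by move=> m x; exact: prod1.
move=> m; apply: (expectation_bounded_limit
  (F_ := fun k x => \prod_i G m.+1%:R k x i)
  (F := fun x => \prod_i G' m.+1%:R x i)) => //.
- by move=> k; exact: (trig_poly_measurable (tG _ _) mU).
- by move=> k; exact: (trig_poly_measurable (tG _ _) mV).
- by move=> k x; exact: prod1.
- by move=> k; exact: (expectation_trig_poly (tG m.+1%:R k)).
Unshelve. all: by end_near. Qed.

Let tup (W : 'I_n -> Omega -> R) w := [tuple W i w | i < n].

Lemma measurable_tup (W : 'I_n -> Omega -> R) :
  (forall i, measurable_fun setT (W i)) -> measurable_fun setT (tup W).
Proof.
move=> mW; apply/measurable_fun_tnthP => i.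
by rewrite (_ : _ \o _ = W i)//; apply/funext => w; rewrite /= tnth_mktuple.
Qed.

Lemma measurable_quadrant (a : 'I_n -> option R) :
  measurable [set x : n.-tuple R | quadrant a (tnth x)].
Proof.
rewrite (_ : mkset _ = \bigcap_(i in [set: 'I_n])
    [set x : n.-tuple R | (if a i is Some r then r < tnth x i else true) : bool]).
  apply: fin_bigcap_measurable => // i _.
  case: (a i) => [r|]; last by rewrite (_ : mkset _ = setT)//; exact/seteqP.
  rewrite -[X in measurable X]setTI.
  rewrite (_ : mkset _ = (@tnth n R)^~ i @^-1` `]r, +oo[).
    exact: measurable_tnth.
  by apply/seteqP; split => x /=; rewrite in_itv/= andbT.
apply/seteqP; split => x /=; first by move=> /forallP qx i _; exact: qx.
by move=> qx; apply/forallP => i; exact: qx.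
Qed.

Lemma tuple_measurable_quadrants : @measurable _ (n.-tuple R) =
  <<s [set A | exists a, A = [set x : n.-tuple R | quadrant a (tnth x)]] >>.
Proof.
set G := mkset _; apply/seteqP; split; last first.
  apply: smallest_sub; first exact: sigma_algebra_measurable.
  by move=> _ [a ->]; exact: measurable_quadrant.
apply: smallest_sub; first exact: smallest_sigma_algebra.
rewrite -bigcup_seq/= => A [i /= _] [B mB <-].
have : measurable_fun (setT : set (g_sigma_algebraType G)) (@tnth n R ^~ i).
  apply: (measurability _ (RGenOInfty.measurableE R)).
  move=> _ [_ [r ->] <-]; apply: sub_sigma_algebra.
  exists (fun j => if j == i then Some r else None).
  rewrite setTI; apply/seteqP; split=> x /=; rewrite in_itv/= andbT.
    by move=> rx; apply/forallP => j; case: eqP => // ->.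
  by move=> /forallP/(_ i); rewrite eqxx.
by move=> /(_ measurableT B mB).
Qed.

(** Two finite measures that agree on the pi-system of quadrants agree on the
    sigma-algebra that it generates. *)
Lemma eq_distribution (B : set (n.-tuple R)) : measurable B ->
  pushforward P (tup U) B = pushforward P (tup V) B.
Proof.
have mtU := measurable_tup mU; have mtV := measurable_tup mV.
move: B; apply: (@measure_unique _ _ _ _ (fun=> setT) tuple_measurable_quadrants
  _ _ _ (pushforward P (tup U)) (pushforward P (tup V))).
- move=> _ _ [a ->] [b ->].
  exists (fun i => if a i is Some r then
      if b i is Some s then Some (Num.max r s) else Some r else b i).
  apply/seteqP; split => x /=.
    move=> [/forallP ax /forallP bx]; apply/forallP => i.
    move: (ax i) (bx i); case: (a i) => [r|]; case: (b i) => [s|]//.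
    by move=> rx sx; rewrite gt_max rx.
  move=> /forallP abx; split; apply/forallP => i; move: (abx i);
    case: (a i) => [r|]; case: (b i) => [s|]//.
  - by rewrite gt_max => /andP[].
  - by rewrite gt_max => /andP[].
- move=> _; exists (fun=> None); apply/seteqP; split => // x _ /=.
  exact/forallP.
- by rewrite bigcup_const//; exists 0%N.
- move=> _ [a ->].
  have quadrantE W : (forall i, measurable_fun setT (W i)) ->
      pushforward P (tup W) [set x : n.-tuple R | quadrant a (tnth x)] =
      (\int[P]_w (quadrant a (W ^~ w))%:R)%:E.
    move=> mW; rewrite /pushforward.
    set A := _ @^-1` _.
    have mA : measurable A.
      rewrite -[A]setTI; apply: measurable_tup => //; exact: measurable_quadrant.
    rewrite -[LHS]fineK ?fin_num_measure//; congr (_%:E).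
    rewrite -[A in LHS]setIT -integral_indic//; apply: eq_Rintegral => w _.
    have tupE : tnth (tup W w) = W ^~ w.
      by apply/funext => i; rewrite tnth_mktuple.
    by rewrite indicE /A -tupE; congr (nat_of_bool _)%:R; apply/idP/idP; rewrite inE.
  exact: (etrans (quadrantE U mU) (etrans (congr1 EFin (expectation_quadrant a))
    (esym (quadrantE V mV)))).
- move=> _; rewrite -[X in (X < _)%E]/(P setT).
  by rewrite probability_setT ltry.
Qed.

End cosine_uniqueness.

(** * Cosine of a sum of independent phases *)

Import HBNNSimple.

Section independence.
Context {R : realType} {d d' : measure_display}.
Context {Omega : measurableType d} {T : measurableType d'}.
Variable P : probability Omega R.

Section factorization.
Variables (G : Omega -> R) (Y : Omega -> T) (K : R).
Hypothesis mG : measurable_fun setT G.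
Hypothesis G1 : forall w, `|G w| <= 1.
Hypothesis mY : measurable_fun setT Y.
Hypothesis GY : forall B, measurable B ->
  \int[P]_w (G w * \1_B (Y w)) = K * \int[P]_w \1_B (Y w).

Let bounded_meas (f : T -> R) :=
  measurable_fun setT f /\ exists M : R, forall y, `|f y| <= M.
Let factors (f : T -> R) :=
  \int[P]_w (G w * f (Y w)) = K * \int[P]_w f (Y w).

Let integrable1 f : bounded_meas f ->
  P.-integrable setT (EFin \o (fun w => f (Y w))).
Proof.
move=> [mf [M fM]]; apply: (@bounded_integrable _ _ _ _ _ M) => //.
exact: measurableT_comp.
Qed.

Let integrable2 f : bounded_meas f ->
  P.-integrable setT (EFin \o (fun w => G w * f (Y w))).
Proof.
move=> [mf [M fM]]; apply: (@bounded_integrable _ _ _ _ _ (1 * M)).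
  by apply: measurable_funM => //; exact: measurableT_comp.
by move=> w; rewrite normrM ler_pM.
Qed.

Let factorsD f g : bounded_meas f -> bounded_meas g ->
  factors f -> factors g -> factors (f \+ g).
Proof.
move=> bf bg ff fg; rewrite /factors.
rewrite (_ : (fun w => _ * _) =
    (fun w => G w * f (Y w)) \+ (fun w => G w * g (Y w))); last first.
  by apply/funext => w; rewrite mulrDr.
rewrite !RintegralD ?ff ?fg ?mulrDr//; by [exact: integrable1|exact: integrable2].
Qed.

Let factorsZ c f : bounded_meas f -> factors f -> factors (fun y => c * f y).
Proof.
move=> bf ff; rewrite /factors.
under eq_Rintegral do rewrite mulrCA.
rewrite !RintegralZl ?ff ?(mulrCA c)//; by [exact: integrable1|exact: integrable2].
Qed.

Let bounded_measD f g : bounded_meas f -> bounded_meas g -> bounded_meas (f \+ g).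
Proof.
move=> [mf [M fM]] [mg [N gN]]; split; first exact: measurable_funD.
by exists (M + N) => y; rewrite (le_trans (ler_normD _ _))// lerD.
Qed.

Let bounded_measZ c f : bounded_meas f -> bounded_meas (fun y => c * f y).
Proof.
move=> [mf [M fM]]; split; first by apply: measurable_funM => //; exact: measurable_cst.
by exists (`|c| * M) => y; rewrite normrM ler_wpM2l.
Qed.

Let factors_indic B : measurable B -> bounded_meas \1_B /\ factors \1_B.
Proof.
move=> mB; split; last exact: GY.
split; first exact: measurable_indic.
by exists 1 => y; rewrite indicE ger0_norm ?lern1 ?leq_b1.
Qed.

Let factors_sum (I : Type) (s : seq I) (c : I -> R) (B : I -> set T) :
  (forall i, measurable (B i)) ->
  let f y := \sum_(i <- s) c i * \1_(B i) y in bounded_meas f /\ factors f.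
Proof.
move=> mB; elim: s => [|i s [bf ff]] /=.
  under eq_fun do rewrite big_nil; split; last first.
    rewrite /factors; under eq_Rintegral do rewrite mulr0.
    by rewrite Rintegral_cst// mul0r mulr0.
  by split; [exact: measurable_cst|exists 0 => y; rewrite normr0].
have [bi fi] := factors_indic (mB i).
under eq_fun do rewrite big_cons.
split; first exact: (bounded_measD (bounded_measZ (c i) bi) bf).
by apply: (factorsD _ bf _ ff); [exact: bounded_measZ|exact: factorsZ].
Qed.

Let factors_ge0 (f : T -> R) (M : R) : measurable_fun setT f ->
  (forall y, 0 <= f y <= M) -> factors f.
Proof.
move=> mf fM.
have f0 y : [set: T] y -> (0 <= (EFin \o f) y)%E.
  by move=> _ /=; rewrite lee_fin; have /andP[] := fM y.
have mfE : measurable_fun setT (EFin \o f) by exact/measurable_EFinP.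
pose h k : T -> R := nnsfun_approx measurableT mfE k.
have h0 k y : 0 <= h k y by exact: fun_ge0.
have hM k y : `|h k y| <= M.
  rewrite ger0_norm//; have /andP[_] := fM y; apply: le_trans.
  by rewrite /h nnsfun_approxE -lee_fin; exact: le_approx.
have hf y : h k y @[k --> \oo] --> f y.
  by have /fine_cvg := cvg_nnsfun_approx measurableT mfE f0 (I : setT y).
have hfac k : bounded_meas (h k) /\ factors (h k).
  pose g := nnsfun_approx measurableT mfE k.
  pose s : seq R := finmap.enum_fset (fset_set (range g)).
  rewrite (_ : h k = (fun y => \sum_(r <- s) r * \1_(g @^-1` [set r]) y)).
    have mg r : measurable (g @^-1` [set r]) by [].
    exact: (@factors_sum R s id (fun r => g @^-1` [set r]) mg).
  by apply/funext => y; rewrite /h fimfunE fsbig_finite.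
have mhY k : measurable_fun setT (fun w => h k (Y w)).
  by apply: measurableT_comp => //; have [[]] := hfac k.
have c1 : \int[P]_w (G w * h k (Y w)) @[k --> \oo] --> \int[P]_w (G w * f (Y w)).
  apply: (@bounded_cvg_Rintegral _ _ _ _ _ _ (1 * M)) => [k|k w|w].
  - exact: measurable_funM.
  - by rewrite normrM ler_pM.
  - exact: cvgMl_tmp.
have c2 : K * \int[P]_w h k (Y w) @[k --> \oo] --> K * \int[P]_w f (Y w).
  by apply: cvgMl_tmp; apply: (@bounded_cvg_Rintegral _ _ _ _ _ _ M).
have e : (fun k => \int[P]_w (G w * h k (Y w))) = (fun k => K * \int[P]_w h k (Y w)).
  by apply/funext => k; have [] := hfac k.
by rewrite e in c1; exact: (cvg_unique _ c1 c2).
Qed.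

(** A product rule that holds for the indicators of measurable sets extends to bounded
    measurable functions: by linearity to simple functions, by bounded convergence to
    nonnegative functions, and by adding a constant to the others. *)
Lemma expectation_factor (f : T -> R) (M : R) : measurable_fun setT f ->
  (forall y, `|f y| <= M) ->
  \int[P]_w (G w * f (Y w)) = K * \int[P]_w f (Y w).
Proof.
move=> mf fM.
have -> : f = (fun y => f y + M) \+ (fun=> - M).
  by apply/funext => y; rewrite /= addrK.
have [bT fT] := factors_indic measurableT.
have cM : (fun=> - M) = (fun y : T => - M * \1_setT y) :> (T -> R).
  by apply/funext => y; rewrite indicT mulr1.
have mfM : measurable_fun setT (fun y => f y + M).
  by apply: measurable_funD => //; exact: measurable_cst.
have f0 y : 0 <= f y + M <= M + M.
  have := fM y; rewrite ler_norml => /andP[h1 h2].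
  by rewrite -lerBlDr sub0r h1 lerD2r.
apply: factorsD.
- by split => //; exists (M + M) => y; have /andP[h1 h2] := f0 y; rewrite ger0_norm.
- by rewrite cM; exact: bounded_measZ.
- exact: factors_ge0 f0.
- by rewrite cM; exact: factorsZ.
Qed.

End factorization.

Lemma Rintegral_indic (A : set Omega) : measurable A ->
  \int[P]_w \1_A w = fine (P A).
Proof. by move=> mA; rewrite /Rintegral integral_indic// setIT. Qed.

Lemma measurable_fun_sin : measurable_fun setT (@sin R).
Proof. by apply: continuous_measurable_fun => x; exact: continuous_sin. Qed.

Section cos_sum.
Variables (N : nat) (Y : 'I_N -> Omega -> T) (u : 'I_N -> T -> R).
Variable phi : 'I_N -> R.
Hypothesis mY : forall i, measurable_fun setT (Y i).
Hypothesis mu : forall i, measurable_fun setT (u i).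
Hypothesis indepY : mutually_independent P Y.
Hypothesis cosY : forall i, \int[P]_w cos (u i (Y i w)) = phi i.
Hypothesis sinY : forall i, \int[P]_w sin (u i (Y i w)) = 0.

Let muY i : measurable_fun setT (fun w => u i (Y i w)).
Proof. exact: measurableT_comp. Qed.

Let mcos (f : Omega -> R) :
  measurable_fun setT f -> measurable_fun setT (fun w => cos (f w)).
Proof. by move=> mf; apply: measurableT_comp => //; exact: measurable_fun_cos. Qed.

Let mindicY i B : measurable B -> measurable_fun setT (fun w => \1_B (Y i w) : R).
Proof. by move=> mB; apply: measurableT_comp => //; exact: measurable_indic. Qed.

Let msin (f : Omega -> R) :
  measurable_fun setT f -> measurable_fun setT (fun w => sin (f w)).
Proof. by move=> mf; apply: measurableT_comp => //; exact: measurable_fun_sin. Qed.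

Let sin1 (x : R) : `|sin x| <= 1.
Proof. by rewrite ler_norml sin_geN1 sin_le1. Qed.

Let cos1 (x : R) : `|cos x| <= 1.
Proof. by rewrite ler_norml cos_geN1 cos_le1. Qed.

Let expectation_indic_prod (B : 'I_N -> set T) : (forall i, measurable (B i)) ->
  \int[P]_w \prod_i \1_(B i) (Y i w) = \prod_i \int[P]_w \1_(B i) (Y i w) :> R.
Proof.
move=> mB.
have mYB i : measurable (Y i @^-1` B i).
  by rewrite -[X in measurable X]setTI; exact: mY.
transitivity (fine (P (\bigcap_(i in setT) (Y i @^-1` B i)))).
  rewrite -Rintegral_indic; last exact: fin_bigcap_measurable.
  apply: eq_Rintegral => w _; rewrite indicE.
  have [wB|] := boolP [forall i, `[< B i (Y i w) >]].
    have {}wB i : B i (Y i w) by have /forallP/(_ i)/asboolP := wB.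
    rewrite mem_set; last by move=> i _; exact: wB.
    by rewrite big1// => i _; rewrite indicE mem_set.
  move=> /forallPn[i /asboolPn nB].
  rewrite memNset; last by move=> /(_ i I).
  by rewrite (bigD1 i)//= indicE memNset// mul0r.
rewrite indepY//.
rewrite (eq_bigr (fun i => (\int[P]_w \1_(B i) (Y i w))%:E)) => [|i _].
  by rewrite prodEFin.
rewrite -[LHS]fineK ?fin_num_measure// -Rintegral_indic//.
Qed.

Let expectation_indicT i : \int[P]_w \1_[set: T] (Y i w) = 1 :> R.
Proof.
rewrite indicT [LHS](_ : _ = \int[P]_w (cst 1 w))//.
by rewrite Rintegral_cst// mul1r; exact: (congr1 fine (probability_setT P)).
Qed.

(** The phases are added one at a time.  The sets B i keep track of what is left:
    freeing the set B i of an index outside s gives the factorization hypothesis of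
    expectation_factor for Y i, and then B i = setT makes room for the phase of index
    i.  The sines have expectation 0, so that only the cosines contribute. *)
Let cos_sum_indic (s : seq 'I_N) (B : 'I_N -> set T) (b : R) : uniq s ->
  (forall i, measurable (B i)) -> {in s, forall i, B i = setT} ->
  \int[P]_w (cos (\sum_(i <- s) u i (Y i w) + b) * \prod_i \1_(B i) (Y i w)) =
  cos b * \prod_(i <- s) phi i * \prod_i \int[P]_w \1_(B i) (Y i w).
Proof.
have indic1 (C : set T) y : `|\1_C y| <= 1 :> R.
  by rewrite indicE ger0_norm ?lern1 ?leq_b1.
elim: s => [|i s IHs] in B b *.
  move=> _ mB _; under eq_Rintegral do rewrite big_nil add0r.
  rewrite big_nil mulr1 -expectation_indic_prod// RintegralZl//.
  apply: (@bounded_integrable _ _ _ _ _ 1) => [|w].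
    by apply: measurable_prod => j _; exact: mindicY.
  by rewrite normr_prod; apply: prodr_ile1 => j _; rewrite normr_ge0/=.
move=> /= /andP[nis us] mB sB.
pose G c w := cos (\sum_(j <- s) u j (Y j w) + c) *
  \prod_(j | j != i) \1_(B j) (Y j w).
pose K c := cos c * \prod_(j <- s) phi j *
  \prod_(j | j != i) \int[P]_w \1_(B j) (Y j w).
have mG c : measurable_fun setT (G c).
  apply: measurable_funM; last first.
    under eq_fun do rewrite -big_filter.
    by apply: measurable_prod => j _; exact: mindicY.
  apply: mcos; apply: measurable_funD; last exact: measurable_cst.
  by apply: measurable_sum => j.
have G1 c w : `|G c w| <= 1.
  rewrite normrM mulr_ile1// normr_prod.
  by apply: prodr_ile1 => j _; rewrite normr_ge0/=.
have fac c (f : T -> R) M : measurable_fun setT f -> (forall y, `|f y| <= M) ->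
    \int[P]_w (G c w * f (Y i w)) = K c * \int[P]_w f (Y i w).
  apply: expectation_factor => //.
  move=> C mC; pose B' j := if j == i then C else B j.
  have mB' j : measurable (B' j) by rewrite /B'; case: eqP.
  have sB' : {in s, forall j, B' j = setT}.
    move=> j js; rewrite /B' ifN; last by apply: contraNneq nis => <-.
    by apply: sB; rewrite inE js orbT.
  have B'i : B' i = C by rewrite /B' eqxx.
  have B'j j : j != i -> B' j = B j by rewrite /B' => /negPf ->.
  transitivity (\int[P]_w (cos (\sum_(j <- s) u j (Y j w) + c) *
      \prod_j \1_(B' j) (Y j w))).
    apply: eq_Rintegral => w _; rewrite [in RHS](bigD1 i)//= B'i.
    rewrite /G -mulrA (mulrC (\1_C _)); congr (_ * (_ * _)).
    by apply: eq_bigr => j ji; rewrite B'j.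
  rewrite IHs// (bigD1 i)//= B'i /K.
  rewrite [RHS]mulrAC -[RHS]mulrA; congr (_ * (_ * _)).
  by apply: eq_bigr => j ji; rewrite B'j.
have Bi : B i = setT by apply: sB; rewrite mem_head.
transitivity (\int[P]_w (G b w * cos (u i (Y i w))) +
  \int[P]_w (G (b + pi / 2) w * sin (u i (Y i w)))).
  rewrite -RintegralD//; last 2 first.
  - apply: (@bounded_integrable _ _ _ _ _ 1) => [|w].
      by apply: measurable_funM => //; exact: mcos.
    by rewrite normrM mulr_ile1.
  - apply: (@bounded_integrable _ _ _ _ _ 1) => [|w].
      by apply: measurable_funM => //; exact: msin.
    by rewrite normrM mulr_ile1.
  apply: eq_Rintegral => w _; rewrite big_cons (bigD1 i)//= Bi indicT mul1r /G.
  (* The second term of the addition formula is written with a shifted cosine, because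
     the induction hypothesis speaks of cosines with an arbitrary phase. *)
  have cosE S x : cos (x + S + b) =
      cos (S + b) * cos x + cos (S + (b + pi / 2)) * sin x.
    rewrite addrA (cosD (S + b) (pi / 2)) cos_pihalf sin_pihalf.
    by rewrite -addrA [x + _]addrC (cosD (S + b)); ring.
  by rewrite cosE mulrDl mulrAC; congr (_ + _); rewrite mulrAC.
have mcosu : measurable_fun setT (cos \o u i).
  exact: (measurableT_comp (@measurable_fun_cos R)).
have msinu : measurable_fun setT (sin \o u i).
  exact: (measurableT_comp measurable_fun_sin).
rewrite (fac b _ 1 mcosu) => [|y]; last exact: cos1.
rewrite (fac _ _ 1 msinu) => [|y]; last exact: sin1.
rewrite /= cosY sinY mulr0 addr0 /K big_cons [in RHS](bigD1 i)//= Bi.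
by rewrite expectation_indicT; ring.
Qed.

Lemma expectation_cos_sum (b : R) :
  \int[P]_w cos (\sum_i u i (Y i w) + b) = cos b * \prod_i phi i.
Proof.
have := @cos_sum_indic (index_enum 'I_N) (fun=> setT) b (index_enum_uniq _)
  (fun=> measurableT) (fun _ _ => erefl).
have prod1 w : \prod_i \1_[set: T] (Y i w) = 1 :> R.
  by apply: big1 => i _; rewrite indicT.
under eq_Rintegral do rewrite prod1 mulr1.
by move=> ->; rewrite [X in _ * X]big1 ?mulr1.
Qed.

End cos_sum.
End independence.

(** * Integrals of simple functions *)

Section complex_functions.
Context {R : realType}.
Implicit Types (z : R[i]) (r : R).

Lemma modulus_ge0 z : 0 <= modulus z.
Proof. by case: z => a b; exact: sqrtr_ge0. Qed.

Lemma modulusM z1 z2 : modulus (z1 * z2) = modulus z1 * modulus z2.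
Proof. exact: complex.ComplexField.Normc.normcM. Qed.

Lemma modulus0 : modulus (0 : R[i]) = 0.
Proof. exact: complex.ComplexField.Normc.normc0. Qed.

Lemma le_modulusD z1 z2 : modulus (z1 + z2) <= modulus z1 + modulus z2.
Proof. exact: complex.le_normcD. Qed.

Lemma modulusN z : modulus (- z) = modulus z.
Proof. exact: complex.normcN. Qed.

Lemma modulus_conj z : modulus (conjc z) = modulus z.
Proof. by case: z => a b; rewrite /modulus/= sqrrN. Qed.

Lemma modulus_real r : modulus r%:C%C = `|r|.
Proof. by rewrite /modulus/= expr0n addr0 sqrtr_sqr. Qed.

Lemma modulus_expi r : modulus (expi r) = 1.
Proof. by rewrite /modulus/= cos2Dsin2 sqrtr1. Qed.

Lemma modulus_Re z : `|complex.Re z| <= modulus z.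
Proof.
by case: z => a b; rewrite /modulus/= -sqrtr_sqr ler_wsqrtr// lerDl sqr_ge0.
Qed.

Lemma ReD z1 z2 : complex.Re (z1 + z2) = complex.Re z1 + complex.Re z2.
Proof. by case: z1; case: z2. Qed.

Lemma Re_sum (I : Type) (s : seq I) (f : I -> R[i]) :
  complex.Re (\sum_(i <- s) f i) = \sum_(i <- s) complex.Re (f i).
Proof. exact: (big_morph _ ReD). Qed.

Section measurability.
Context {d : measure_display} {T : measurableType d}.
Implicit Types f g : T -> R[i].

Lemma measurable_complexP f : measurable_complex f <->
  measurable_fun setT (fun x => complex.Re (f x)) /\
  measurable_fun setT (fun x => complex.Im (f x)).
Proof.
split=> [mf|[mr mi]]; last exact: measurable_fun_pair.
by split; [exact: (measurableT_comp measurable_fst mf)|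
           exact: (measurableT_comp measurable_snd mf)].
Qed.

Lemma measurable_complexD f g : measurable_complex f -> measurable_complex g ->
  measurable_complex (fun x => f x + g x).
Proof.
move=> /measurable_complexP[fr fi] /measurable_complexP[gr gi].
apply/measurable_complexP; split.
  rewrite (_ : (fun _ => _) = (fun x => complex.Re (f x)) \+ (fun x => complex.Re (g x))).
    exact: measurable_funD.
  by apply/funext => x; rewrite ReD.
rewrite (_ : (fun _ => _) = (fun x => complex.Im (f x)) \+ (fun x => complex.Im (g x))).
  exact: measurable_funD.
by apply/funext => x /=; case: (f x); case: (g x).
Qed.

Lemma measurable_complexM f g : measurable_complex f -> measurable_complex g ->
  measurable_complex (fun x => f x * g x).
Proof.
move=> /measurable_complexP[fr fi] /measurable_complexP[gr gi].
apply/measurable_complexP; split.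
  rewrite (_ : (fun _ => _) = (fun x => complex.Re (f x) * complex.Re (g x)) \-
      (fun x => complex.Im (f x) * complex.Im (g x))).
    by apply: measurable_funB; exact: measurable_funM.
  by apply/funext => x /=; case: (f x); case: (g x).
rewrite (_ : (fun _ => _) = (fun x => complex.Re (f x) * complex.Im (g x)) \+
    (fun x => complex.Im (f x) * complex.Re (g x))).
  by apply: measurable_funD; exact: measurable_funM.
by apply/funext => x /=; case: (f x); case: (g x).
Qed.

Lemma measurable_complex_cst z : measurable_complex (fun _ : T => z).
Proof. by apply/measurable_complexP; split; exact: measurable_cst. Qed.

Lemma measurable_complexB f g : measurable_complex f -> measurable_complex g ->
  measurable_complex (fun x => f x - g x).
Proof.
move=> mf mg.
rewrite (_ : (fun _ => _) = fun x => f x + (-1) * g x).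
  by apply: measurable_complexD => //; exact: measurable_complexM (measurable_complex_cst _) _.
by apply/funext => x; rewrite mulN1r.
Qed.

Lemma measurable_complex_sum (I : eqType) (s : seq I) (f : I -> T -> R[i]) :
  (forall i, i \in s -> measurable_complex (f i)) ->
  measurable_complex (fun x => \sum_(i <- s) f i x).
Proof.
elim: s => [|i s IHs] mf.
  by under eq_fun do rewrite big_nil; exact: measurable_complex_cst.
under eq_fun do rewrite big_cons.
apply: measurable_complexD; first by apply: mf; rewrite mem_head.
by apply: IHs => j js; apply: mf; rewrite inE js orbT.
Qed.

Lemma measurable_complex_real (f : T -> R) : measurable_fun setT f ->
  measurable_complex (fun x => (f x)%:C%C).
Proof. by move=> mf; apply/measurable_complexP; split => //; exact: measurable_cst. Qed.

Lemma measurable_Re f : measurable_complex f ->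
  measurable_fun setT (fun x => complex.Re (f x)).
Proof. by move=> /measurable_complexP[]. Qed.

Lemma measurable_cosDr (f : T -> R) (b : R) : measurable_fun setT f ->
  measurable_fun setT (fun x => cos (f x + b)).
Proof.
move=> mf; apply: (measurableT_comp (@measurable_fun_cos R)).
by apply: measurable_funD => //; exact: measurable_cst.
Qed.

Lemma measurable_modulus f : measurable_complex f ->
  measurable_fun setT (fun x => modulus (f x)).
Proof.
move=> /measurable_complexP[fr fi].
rewrite (_ : (fun _ => _) = Num.sqrt \o
    ((fun x => complex.Re (f x) ^+ 2) \+ (fun x => complex.Im (f x) ^+ 2))).
  apply: measurableT_comp.
    by apply: continuous_measurable_fun => x; exact: sqrt_continuous.
  by apply: measurable_funD; exact: measurable_funX.
by apply/funext => x /=; case: (f x).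
Qed.

Lemma measurable_modulus_powR f (a : R) : measurable_complex f ->
  measurable_fun setT (fun x => (modulus (f x) `^ a)%:E).
Proof.
move=> mf; apply/measurable_EFinP.
apply: (measurableT_comp (measurable_powR a)); exact: measurable_modulus.
Qed.

End measurability.
End complex_functions.

Section simple_integrals.
Context {R : realType} {d d' : measure_display} {Omega : measurableType d}
  {T : measurableType d'}.
Variables (P : probability Omega R) (m : {measure set T -> \bar R}).
Variables (alpha c0 : R).
Variable W : set T -> Omega -> R[i].
Hypothesis W_SaS : isotropic_SaS_random_measure P m alpha c0 W.
Hypothesis alpha_gt0 : 0 < alpha.

Lemma finite_measurable0 : finite_measurable m set0.
Proof. by split; rewrite ?measure0. Qed.

Lemma finite_measurableS (A B : set T) : measurable A -> A `<=` B ->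
  finite_measurable m B -> finite_measurable m A.
Proof.
move=> mA AB [mB Boo]; split => //; apply: le_lt_trans Boo.
by apply: le_measure => //; rewrite inE.
Qed.

(** A sequence that converges to 0 and eventually stays above the modulus of z forces
    z = 0. *)
Lemma modulus_le_cvg0 (z : R[i]) (u : nat -> R) (N : nat) :
  (forall n, (N <= n)%N -> modulus z <= u n) -> u @ \oo --> (0 : R) -> z = 0.
Proof.
move=> zu u0; apply: complex.ComplexField.Normc.eq0_normc; rewrite -/(modulus z).
apply/eqP; rewrite eq_le modulus_ge0 andbT leNgt; apply/negP => z0.
have /cvgrPdist_lt/(_ _ z0) h := u0.
have [n [/= uz Nn]] := filter_ex (filterI h (nbhs_infty_ge N)).
have := lt_le_trans uz (zu n Nn).
by rewrite sub0r normrN ltNge ler_norm.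
Qed.

(** Sigma-additivity for the constant sequence set0 makes the partial sums n * W set0
    converge. *)
Lemma SaS_set0 : {ae P, forall w, W set0 w = 0}.
Proof.
have : {ae P, forall w, modulus (\sum_(0 <= k < n) W set0 w -
    W (\bigcup_(k in [set: nat]) set0) w) @[n --> \oo] --> (0 : R)}.
  apply: (SaS_sigma_additive W_SaS (A := fun=> set0)) => //.
  - by move=> _; exact: finite_measurable0.
  - exact: trivIset_set0.
  - by rewrite bigcup0//; exact: finite_measurable0.
apply: filterS => w; rewrite bigcup0//.
apply: (@modulus_le_cvg0 _ _ 2) => -[|[|n]] // _.
rewrite sumr_const_nat subn0 mulrSr addrK /modulus complex.normcMn mulrS lerDl.
by rewrite mulrn_wge0// modulus_ge0.
Qed.

(** Sigma-additivity applied to the family extended by empty sets. *)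
Lemma SaS_additive N (F : 'I_N -> set T) :
  (forall i, finite_measurable m (F i)) -> trivIset setT F ->
  finite_measurable m (\bigcup_(i in setT) F i) ->
  {ae P, forall w, W (\bigcup_(i in setT) F i) w = \sum_i W (F i) w}.
Proof.
move=> fF tF fUF; pose F' k := if insub k is Some i then F i else set0.
have F'F (i : 'I_N) : F' i = F i by rewrite /F' insubT// => lt_iN; congr F; exact/val_inj.
have F'0 k : (N <= k)%N -> F' k = set0 by move=> Nk; rewrite /F' insubF// ltnNge Nk.
have fF' k : finite_measurable m (F' k).
  by rewrite /F'; case: insub => [i|] //; exact: finite_measurable0.
have UF : \bigcup_k F' k = \bigcup_(i in setT) F i.
  apply/seteqP; split => x [k _]; last by move=> Fx; exists k => //; rewrite F'F.
  by rewrite /F'; case: insubP => // i _ _ Fx; exists i.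
have tF' : trivIset setT F'.
  apply/trivIsetP => i j _ _ ij; rewrite /F'.
  case: insubP => [i' _ ei|_]; last by rewrite set0I.
  case: insubP => [j' _ ej|_]; last by rewrite setI0.
  have /trivIsetP := tF; apply => //.
  by apply: contra ij => /eqP e; rewrite -ei -ej e.
have fU : finite_measurable m (\bigcup_k F' k) by rewrite UF.
have := SaS_sigma_additive W_SaS fF' tF' fU.
rewrite UF; apply: (filterS2 _ _ SaS_set0) => w W0 h.
apply/eqP; rewrite eq_sym -subr_eq0; apply/eqP; move: h.
apply: (@modulus_le_cvg0 _ _ N) => n Nn.
have tail0 : \sum_(N <= k < n) W (F' k) w = 0.
  by rewrite big_nat big1// => k /andP[Nk _]; rewrite F'0.
rewrite (big_cat_nat (n := N))//= tail0 addr0 big_mkord.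
rewrite (_ : \sum_(i < N) W (F' i) w = \sum_i W (F i) w)//.
by apply: eq_bigr => i _; rewrite F'F.
Qed.

Lemma finite_measure_fin (B : set T) : finite_measurable m B -> m B \is a fin_num.
Proof. by move=> [_ Boo]; rewrite ge0_fin_numE. Qed.

Lemma measurable_simple_integral (s : seq (R[i] * set T)) : simple_data m s ->
  measurable_complex (simple_integral W s).
Proof.
move=> fs; apply: measurable_complex_sum => p ps.
apply: measurable_complexM; first exact: measurable_complex_cst.
by apply: (SaS_measurable W_SaS); exact: fs.
Qed.

Section atoms.
Variable s : seq (R[i] * set T).
Hypothesis s_data : simple_data m s.

Let n := size s.
Let z (j : 'I_n) : R[i] := (tnth (in_tuple s) j).1.
Let A (j : 'I_n) : set T := (tnth (in_tuple s) j).2.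
Let pattern := {ffun 'I_n -> bool}.

Let fA j : finite_measurable m (A j).
Proof. by apply: s_data; exact: mem_tnth. Qed.

(** The sets of a simple function overlap in general.  They are cut into the disjoint
    atoms of points that belong to the same sets; an atom is indexed by the pattern of
    the sets that contain it. *)
Definition members (x : T) : {ffun 'I_(size s) -> bool} := [ffun j => `[< A j x >]].

(** The points outside all the sets may have infinite measure; their atom is replaced
    by the empty set, which is harmless because its coefficient is 0. *)
Definition atom (J : {ffun 'I_(size s) -> bool}) : set T :=
  if J == [ffun=> false] then set0 else [set x | members x = J].

Definition atom_coef (J : {ffun 'I_(size s) -> bool}) : R[i] := \sum_(j | J j) z j.

Lemma measurable_atom J : measurable (atom J).
Proof.
rewrite /atom; case: eqP => // _.
rewrite (_ : mkset _ = \bigcap_(j in setT) (if J j then A j else ~` A j)).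
  apply: fin_bigcap_measurable => [|j _]; first exact: finite_finset.
  by case: ifP => _; [|apply: measurableC]; have [] := fA j.
apply/seteqP; split => [x <- j _|x Jx].
  by rewrite ffunE; case: ifPn => /asboolP.
apply/ffunP => j; rewrite ffunE; have := Jx j I.
by case: ifP => _ h; apply/asboolP.
Qed.

Lemma atomP J x : atom J x -> members x = J.
Proof. by rewrite /atom; case: eqP. Qed.

Lemma atom_sub (J : pattern) j : J j -> atom J `<=` A j.
Proof. by move=> Jj x /atomP e; move: Jj; rewrite -e ffunE => /asboolP. Qed.

Lemma finite_measurable_atom J : finite_measurable m (atom J).
Proof.
have [/forallP J0|/forallPn[j]] := boolP [forall j, ~~ J j].
  rewrite /atom ifT; first exact: finite_measurable0.
  by apply/eqP/ffunP => j; rewrite ffunE; apply/negbTE.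
rewrite negbK => Jj; apply: finite_measurableS (fA j); first exact: measurable_atom.
exact: atom_sub.
Qed.

Let N := #|{: pattern}|.
Let B (i : 'I_N) : set T := atom (enum_val i).
Let c (i : 'I_N) : R[i] := atom_coef (enum_val i).

Let tB : trivIset setT B.
Proof.
apply/trivIsetP => i j _ _; apply: contraNeq => /set0P[x [/atomP xi /atomP xj]].
by apply/eqP/enum_val_inj; rewrite -xi.
Qed.

Let split_A (j : 'I_n) :
  A j = \bigcup_(i in setT) (if (enum_val i : pattern) j then B i else set0).
Proof.
apply/seteqP; split => [x Ax|x [i _]]; last by case: ifP => // ij; exact: atom_sub.
exists (enum_rank (members x)) => //.
have mj : members x j by rewrite ffunE; exact/asboolP.
rewrite /B enum_rankK mj /atom ifN//; apply: contraTneq mj => ->.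
by rewrite ffunE.
Qed.

Lemma simple_fun_atoms x : simple_fun s x = atom_coef (members x).
Proof.
rewrite /simple_fun big_tnth /atom_coef [RHS]big_mkcond/=; apply: eq_bigr => j _.
rewrite ffunE indicE; case: asboolP => Ax; first by rewrite mem_set// mulr1.
by rewrite memNset// mulr0.
Qed.

Lemma simple_integral_atoms :
  {ae P, forall w, simple_integral W s w = \sum_i c i * W (B i) w}.
Proof.
have tA j : trivIset setT (fun i => if (enum_val i : pattern) j then B i else set0).
  apply/trivIsetP => i k _ _ ik; case: ifP => _; last by rewrite set0I.
  case: ifP => _; last by rewrite setI0.
  by have /trivIsetP := tB; exact.
have fB j i : finite_measurable m (if (enum_val i : pattern) j then B i else set0).
  by case: ifP => _; [exact: finite_measurable_atom|exact: finite_measurable0].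
have Aj j := SaS_additive (fB j) (tA j).
have {}Aj : {ae P, forall w, forall j, W (A j) w =
    \sum_i W (if (enum_val i : pattern) j then B i else set0) w}.
  apply: filter_forall => j; have := Aj j; rewrite -split_A; apply.
  exact: fA.
apply: (filterS2 _ _ SaS_set0 Aj) => w W0 {}Aj.
rewrite /simple_integral big_tnth.
under eq_bigr do rewrite -/(A _) Aj mulr_sumr.
rewrite exchange_big/=; apply: eq_bigr => i _.
rewrite /c /atom_coef mulr_suml [RHS]big_mkcond; apply: eq_bigr => j _.
by case: ifP => // _; rewrite W0 mulr0.
Qed.

Lemma integral_simple_fun :
  (\int[m]_x (modulus (simple_fun s x) `^ alpha)%:E =
   \sum_i (modulus (c i) `^ alpha)%:E * m (B i))%E.
Proof.
have mB i : measurable (B i) by exact: measurable_atom.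
transitivity (\int[m]_x (\sum_i (modulus (c i) `^ alpha)%:E * (\1_(B i) x)%:E))%E.
  apply: eq_integral => x _; rewrite simple_fun_atoms.
  under eq_bigr do rewrite -EFinM.
  rewrite sumEFin; congr (_%:E).
  rewrite (bigD1 (enum_rank (members x)))//= /c /B enum_rankK big1 => [|i ix].
    rewrite addr0 indicE /atom; case: eqP => [->|_].
      rewrite /atom_coef big1 ?modulus0 ?powR0 ?mul0r ?gt_eqF// => j.
      by rewrite ffunE.
    by rewrite mem_set// mulr1.
  rewrite indicE memNset ?mulr0// => /atomP e.
  by move: ix; rewrite e enum_valK eqxx.
rewrite ge0_integral_sum//; last 2 first.
- move=> i; apply/measurable_EFinP.
  by apply: measurable_funM; [exact: measurable_cst|exact: measurable_indic].
- by move=> i x _; rewrite mule_ge0// lee_fin// powR_ge0.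
apply: eq_bigr => i _.
rewrite ge0_integralZl_EFin//; last 2 first.
- by apply/measurable_EFinP; exact: measurable_indic.
- exact: powR_ge0.
by rewrite integral_indic// setIT.
Qed.

Lemma integral_simple_fun_fin :
  (\int[m]_x (modulus (simple_fun s x) `^ alpha)%:E)%E \is a fin_num.
Proof.
rewrite integral_simple_fun; apply/sum_fin_numP => i _.
by rewrite fin_numM//; apply: finite_measure_fin; exact: finite_measurable_atom.
Qed.

Let phase_char i :
  \int[P]_w cos (complex.Re (c i * W (B i) w)) =
    expR (- (c0 * modulus (c i) `^ alpha * fine (m (B i)))) /\
  \int[P]_w sin (complex.Re (c i * W (B i) w)) = 0.
Proof.
have := SaS_char_fun W_SaS (conjc (c i)) (finite_measurable_atom (enum_val i)).
rewrite /char_fun modulus_conj => -[<- <-].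
by split; apply: eq_Rintegral => w _; rewrite conjcK.
Qed.

(** On the disjoint atoms the values of W are independent, and their characteristic
    functions are known; the product of the exponentials is the exponential of the
    integral of the step function. *)
Lemma expectation_cos_simple_integral b :
  \int[P]_w cos (complex.Re (simple_integral W s w) + b) =
  cos b * expR (- (c0 * fine (\int[m]_x (modulus (simple_fun s x) `^ alpha)%:E)%E)).
Proof.
have mW i : measurable_complex (W (B i)).
  exact: (SaS_measurable W_SaS (finite_measurable_atom _)).
transitivity (\int[P]_w cos (\sum_i complex.Re (c i * W (B i) w) + b)).
  rewrite /Rintegral; congr fine; apply: ae_eq_integral => //.
  - exact/measurable_EFinP/measurable_cosDr/measurable_Re/measurable_simple_integral.
  - apply/measurable_EFinP/measurable_cosDr/measurable_sum => i.
    exact/measurable_Re/measurable_complexM/mW/measurable_complex_cst.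
  - apply: filterS simple_integral_atoms => w -> _.
    by rewrite Re_sum.
pose u i (p : R * R) := complex.Re (c i * Complex p.1 p.2).
have uE i w : complex.Re (c i * W (B i) w) = u i ((re_im \o W (B i)) w).
  by rewrite /u /re_im /=; case: (W _ _).
under eq_Rintegral do under eq_bigr do rewrite uE.
rewrite (expectation_cos_sum (Y := fun i => re_im \o W (B i)) (u := u)
  (phi := fun i => expR (- (c0 * modulus (c i) `^ alpha * fine (m (B i)))))).
- rewrite -expR_sum; congr (_ * expR _).
  rewrite integral_simple_fun -sum_fine; last first.
    by move=> i _; rewrite fin_numM//; apply: finite_measure_fin; exact: finite_measurable_atom.
  rewrite sumrN mulr_sumr; congr (- _); apply: eq_bigr => i _.
  by rewrite fineM// ?mulrA//; apply: finite_measure_fin; exact: finite_measurable_atom.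
- exact: mW.
- move=> i; apply/measurable_Re/measurable_complexM.
    exact: measurable_complex_cst.
  by apply/measurable_complexP; split; [exact: measurable_fst|exact: measurable_snd].
- apply: (SaS_independently_scattered W_SaS) => //.
  by move=> i; exact: finite_measurable_atom.
- by move=> i; have [<- _] := phase_char i; apply: eq_Rintegral => w _; rewrite uE.
- by move=> i; have [_ <-] := phase_char i; apply: eq_Rintegral => w _; rewrite uE.
Qed.

End atoms.
End simple_integrals.

(** * Passage to the limit in stochastic integrals *)

Lemma close_of_mutual_bounds (R : realFieldType) (A a x rho eta : R) :
  0 <= A -> 0 <= x -> 1 < rho -> a <= rho * A + x -> A <= rho * a + x ->
  x <= eta / 2 -> (rho - 1) * A <= eta / 2 -> `|A - a| <= eta.
Proof.
move=> A0 x0 rho1 h1 h2 xeta Aeta.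
have rho0 : 0 < rho by lra.
have h3 : a - A <= (rho - 1) * A + x by lra.
have h4 : A - a <= (rho - 1) * A + x.
  rewrite leNgt; apply/negP => lt.
  have : rho * ((rho - 1) * A + x) < rho * (A - a) by rewrite ltr_pM2l//; lra.
  have : 0 <= (rho - 1) ^+ 2 * A by rewrite mulr_ge0 ?sqr_ge0.
  have : 0 <= (rho - 1) * x by rewrite mulr_ge0// subr_ge0 ltW.
  lra.
by rewrite ler_norml; apply/andP; split; lra.
Qed.

(** With rho close to 1 the two bounds squeeze a k towards A, because e k tends to 0
    while C depends on rho only. *)
Lemma cvg_of_mutual_bounds (R : realType) (A : \bar R) (a e : nat -> \bar R) :
  (0 <= A)%E -> (forall k, 0 <= e k)%E -> (forall k, a k \is a fin_num) ->
  (forall rho : R, 1 < rho -> exists2 C : R, 0 <= C & forall k,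
    (a k <= rho%:E * A + C%:E * e k)%E /\ (A <= rho%:E * a k + C%:E * e k)%E) ->
  e @ \oo --> 0%E ->
  A \is a fin_num /\ fine (a k) @[k --> \oo] --> fine A.
Proof.
move=> A_ge0 e_ge0 afin bounds /fine_cvgP[efin e0].
have Afin : A \is a fin_num.
  have [C C0 h] := bounds 2 (ltr1n _ 2).
  have [k efk] := filter_ex efin.
  rewrite ge0_fin_numE//; have [_ /le_lt_trans] := h k; apply.
  by rewrite -(fineK (afin k)) -(fineK efk) -!EFinM -EFinD ltry.
split=> //; apply/cvgrPdist_le => eta eta0.
move: A_ge0 bounds; rewrite -(fineK Afin) lee_fin; set r := fine A => r0 bounds.
pose rho : R := 1 + eta / 2 / (r + 1).
have r1 : 0 < r + 1 by rewrite ltr_wpDl.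
have rho1 : 1 < rho by rewrite ltrDl !divr_gt0.
have [C C0 h] := bounds rho rho1.
have C1 : 0 < C + 1 by rewrite ltr_wpDl.
near=> k.
have efk : e k \is a fin_num by near: k; exact: efin.
have ek : fine (e k) < eta / 2 / (C + 1).
  by near: k; apply: (cvgr_lt 0 e0); rewrite !divr_gt0.
have ek0 : 0 <= fine (e k) by exact: fine_ge0.
have [] := h k; rewrite -(fineK (afin k)) -(fineK efk) -!EFinM -!EFinD !lee_fin.
move=> h1 h2.
apply: (close_of_mutual_bounds _ _ rho1 h1 h2) => //.
- exact: mulr_ge0.
- move: ek; rewrite ltr_pdivlMr// => /ltW; apply: le_trans.
  by rewrite mulrC ler_wpM2l// lerDl.
- rewrite /rho addrC addKr mulrAC ler_pdivrMr//.
  by rewrite ler_wpM2l ?divr_ge0 ?(ltW eta0)// lerDl.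
Unshelve. all: by end_near. Qed.

Lemma cvge0Zl (R : realType) (c : R) (u : nat -> \bar R) :
  u @ \oo --> 0%E -> (c%:E * u k)%E @[k --> \oo] --> 0%E.
Proof. by move=> u0; rewrite -[X in _ --> X](mule0 c%:E); exact: cvgeZl. Qed.

Lemma cvge0D (R : realType) (u v : nat -> \bar R) :
  u @ \oo --> 0%E -> v @ \oo --> 0%E -> (u k + v k)%E @[k --> \oo] --> 0%E.
Proof. by move=> u0 v0; rewrite -[X in _ --> X](adde0 0%E); exact: cvgeD. Qed.

Section energy.
Context {R : realType} {d : measure_display} {T : measurableType d}.
Variables (m : {measure set T -> \bar R}) (alpha : R).
Hypothesis alpha_gt0 : 0 < alpha.
Implicit Types (f g : T -> R[i]) (z : R[i]).

(** The scale parameter, to the power alpha, of the stochastic integral of f. *)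
Definition energy f : \bar R := (\int[m]_x (modulus (f x) `^ alpha)%:E)%E.

Lemma energy_ge0 f : (0 <= energy f)%E.
Proof. by apply: integral_ge0 => x _; rewrite lee_fin powR_ge0. Qed.

(** A substitute for the triangle inequality that serves all exponents alpha > 0 at
    once: if |z2| <= e |z1| then |z1 + z2| <= (1 + e) |z1|, and otherwise
    |z1 + z2| <= (1 + 1 / e) |z2|; here e is chosen so that (1 + e) ^ alpha = rho. *)
Lemma powR_modulusD (rho : R) : 1 < rho -> exists2 C, 0 <= C &
  forall z1 z2, modulus (z1 + z2) `^ alpha <=
    rho * modulus z1 `^ alpha + C * modulus z2 `^ alpha.
Proof.
move=> rho1; have rho0 : 0 < rho by rewrite (lt_trans ltr01).
pose D := rho `^ alpha^-1.
have Da : D `^ alpha = rho by rewrite -powRrM mulVf ?gt_eqF// powRr1// ltW.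
have D1 : 1 < D.
  rewrite ltNge; apply/negP => D1; move: rho1; rewrite ltNge -Da => /negP; apply.
  have <- : 1 `^ alpha = 1 by rewrite powR1.
  by apply: (ge0_ler_powR (ltW alpha_gt0)); rewrite ?nnegrE ?powR_ge0.
pose e := D - 1; have e0 : 0 < e by rewrite subr_gt0.
exists ((1 + e^-1) `^ alpha) => [|z1 z2]; first exact: powR_ge0.
have a0 := ltW alpha_gt0.
have [m1 m2 m12] := And3 (modulus_ge0 z1) (modulus_ge0 z2) (modulus_ge0 (z1 + z2)).
have D0 : 0 <= D by rewrite ltW// (lt_trans ltr01).
have E0 : 0 <= 1 + e^-1 by rewrite addr_ge0 ?invr_ge0 ?ltW.
have := le_modulusD z1 z2.
have [le21|/ltW le12] := leP (modulus z2) (e * modulus z1) => h.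
  apply: (@le_trans _ _ (rho * modulus z1 `^ alpha)); last first.
    by rewrite lerDl mulr_ge0 ?powR_ge0.
  rewrite -Da -powRM//; apply: (ge0_ler_powR (ltW alpha_gt0)); rewrite ?nnegrE ?mulr_ge0//.
  by rewrite (le_trans h)// -[D](subrK 1) -/e addrC mulrDl mul1r lerD2r.
apply: (@le_trans _ _ ((1 + e^-1) `^ alpha * modulus z2 `^ alpha)); last first.
  by rewrite lerDr mulr_ge0 ?powR_ge0 ?ltW.
rewrite -powRM//; apply: (ge0_ler_powR (ltW alpha_gt0)); rewrite ?nnegrE ?mulr_ge0// (le_trans h)//.
by rewrite addrC mulrDl mul1r lerD2l mulrC ler_pdivlMr// mulrC.
Qed.

Lemma energyD (rho : R) : 1 < rho -> exists2 C, 0 <= C &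
  forall f g, measurable_complex f -> measurable_complex g ->
    (energy (fun x => f x + g x)%R <= rho%:E * energy f + C%:E * energy g)%E.
Proof.
move=> rho1; have [C C0 CD] := powR_modulusD rho1.
exists C => // f g mf mg.
have rho0 : 0 <= rho by rewrite ltW// (lt_trans ltr01).
have mpf := measurable_modulus_powR alpha mf.
have mpg := measurable_modulus_powR alpha mg.
have p0 (h : T -> R[i]) x : [set: T] x -> (0 <= (modulus (h x) `^ alpha)%:E)%E.
  by move=> _; rewrite lee_fin powR_ge0.
rewrite /energy -!ge0_integralZl_EFin//; [|exact: p0|exact: p0].
rewrite -ge0_integralD//; last 4 first.
- by move=> x _; rewrite mule_ge0// p0.
- exact: measurable_funeM.
- by move=> x _; rewrite mule_ge0// p0.
- exact: measurable_funeM.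
apply: ge0_le_integral => //.
- exact: p0.
- by apply: measurable_modulus_powR; exact: measurable_complexD.
- by apply: emeasurable_funD; exact: measurable_funeM.
- by move=> x _; rewrite -!EFinM -EFinD lee_fin.
Qed.

Lemma energyN f : energy (fun x => - f x) = energy f.
Proof. by apply: eq_integral => x _; rewrite modulusN. Qed.

Lemma energyZ (c : R[i]) f : measurable_complex f ->
  energy (fun x => c * f x) = ((modulus c `^ alpha)%:E * energy f)%E.
Proof.
move=> mf; rewrite /energy -ge0_integralZl_EFin ?powR_ge0//.
- by apply: eq_integral => x _; rewrite modulusM powRM ?modulus_ge0// EFinM.
- by move=> x _; rewrite lee_fin powR_ge0.
- exact: measurable_modulus_powR.
Qed.

Lemma cvg_energy f (g_ : nat -> T -> R[i]) :
  measurable_complex f -> (forall k, measurable_complex (g_ k)) ->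
  (forall k, energy (g_ k) \is a fin_num) ->
  energy (fun x => f x - g_ k x)%R @[k --> \oo] --> 0%E ->
  energy f \is a fin_num /\
  fine (energy (g_ k)) @[k --> \oo] --> fine (energy f).
Proof.
move=> mf mg gfin.
have mfg k : measurable_complex (fun x => f x - g_ k x) by exact: measurable_complexB.
apply: cvg_of_mutual_bounds => [||//|rho /energyD[C C0 CD]].
- exact: energy_ge0.
- by move=> k; exact: energy_ge0.
exists C => // k; split.
  have := CD _ (fun x => g_ k x - f x) mf (measurable_complexB (mg k) mf).
  have -> : (fun x => f x + (g_ k x - f x)) = g_ k.
    by apply/funext => x; rewrite addrC subrK.
  rewrite -(energyN (fun x => g_ k x - f x)).
  suff -> : (fun x => - (g_ k x - f x)) = (fun x => f x - g_ k x) by [].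
  by apply/funext => x; rewrite opprB.
have := CD _ _ (mg k) (mfg k).
suff -> : (fun x => g_ k x + (f x - g_ k x)) = f by [].
by apply/funext => x; rewrite addrC subrK.
Qed.

End energy.

Lemma cos_lipschitz (R : realType) (x y : R) : `|cos x - cos y| <= `|x - y|.
Proof.
wlog xy : x y / x <= y => [h|].
  by have [/h//|/ltW/h] := leP x y; rewrite distrC (distrC y).
have [|z _] := @MVT_segment R cos (fun z => - sin z) x y xy (fun z _ => is_derive_cos z).
  by apply: continuous_subspaceT => z; exact: continuous_cos.
rewrite distrC => ->; rewrite normrM normrN (distrC x) ler_piMl//.
by rewrite ler_norml sin_geN1 sin_le1.
Qed.

Section stochastic_integral.
Context {R : realType} {d d' : measure_display} {Omega : measurableType d}
  {T : measurableType d'}.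
Variables (P : probability Omega R) (m : {measure set T -> \bar R}).
Variables (alpha c0 : R) (W : set T -> Omega -> R[i]).
Hypothesis W_SaS : isotropic_SaS_random_measure P m alpha c0 W.
Hypothesis alpha_gt0 : 0 < alpha.

Lemma measurable_simple_fun (s : seq (R[i] * set T)) : simple_data m s ->
  measurable_complex (simple_fun s).
Proof.
move=> fs; apply: measurable_complex_sum => p ps.
apply: measurable_complexM; first exact: measurable_complex_cst.
by apply/measurable_complex_real/measurable_indic; have [] := fs _ ps.
Qed.

Lemma measurable_modulus_ge (Z : Omega -> R[i]) (eps : R) : measurable_complex Z ->
  measurable [set w | eps <= modulus (Z w)].
Proof.
move=> mZ; rewrite -[X in measurable X]setTI.
rewrite (_ : mkset _ = (fun w => modulus (Z w)) @^-1` `[eps, +oo[).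
  by apply: measurable_modulus.
by apply/seteqP; split => w /=; rewrite in_itv/= andbT.
Qed.

Lemma cvg_in_probabilityD (Z Z' : nat -> Omega -> R[i]) (Y Y' : Omega -> R[i]) :
  (forall k, measurable_complex (Z k)) -> (forall k, measurable_complex (Z' k)) ->
  measurable_complex Y -> measurable_complex Y' ->
  cvg_in_probability P Z Y -> cvg_in_probability P Z' Y' ->
  cvg_in_probability P (fun k w => Z k w + Z' k w) (fun w => Y w + Y' w).
Proof.
move=> mZ mZ' mY mY' ZY ZY' eps eps0.
have e2 : 0 < eps / 2 by rewrite divr_gt0.
pose A k := [set w | eps / 2 <= modulus (Z k w - Y w)].
pose B k := [set w | eps / 2 <= modulus (Z' k w - Y' w)].
apply: (@squeeze_cvge _ _ _ _ (fun=> 0%E) _ (fun k => P (A k) + P (B k))%E).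
- near=> k; rewrite measure_ge0/=.
  have mA : measurable (A k).
    by apply: measurable_modulus_ge; exact: measurable_complexB.
  have mB : measurable (B k).
    by apply: measurable_modulus_ge; exact: measurable_complexB.
  apply: (le_trans _ (measureU2 P mA mB)); apply: le_measure; rewrite ?inE.
  + by apply: measurable_modulus_ge; apply: measurable_complexB; exact: measurable_complexD.
  + exact: measurableU.
  move=> w /=; rewrite opprD addrACA => h.
  have := le_trans h (le_modulusD _ _).
  have [|lt1] := leP (eps / 2) (modulus (Z k w - Y w)); first by left.
  move=> h'; right; rewrite /B/= leNgt; apply/negP => lt2.
  by have := ltrD lt1 lt2; rewrite -splitr ltNge h'.
- exact: cvg_cst.
- exact: (cvge0D (ZY _ e2) (ZY' _ e2)).
Unshelve. all: by end_near. Qed.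

Lemma cvg_in_probabilityZ (c : R[i]) (Z : nat -> Omega -> R[i]) (Y : Omega -> R[i]) :
  cvg_in_probability P Z Y ->
  cvg_in_probability P (fun k w => c * Z k w) (fun w => c * Y w).
Proof.
move=> ZY eps eps0.
have cE k w : modulus (c * Z k w - c * Y w) = modulus c * modulus (Z k w - Y w).
  by rewrite -mulrBr modulusM.
have [c0'|c0'] := eqVneq (modulus c) 0.
  rewrite (_ : (fun k => _) = fun=> 0%E); first exact: cvg_cst.
  apply/funext => k; rewrite (_ : mkset _ = set0) ?measure0//.
  by apply/seteqP; split => w //=; rewrite cE c0' mul0r leNgt eps0.
have c_gt0 : 0 < modulus c by rewrite lt_neqAle eq_sym c0' modulus_ge0.
rewrite (_ : (fun k => _) =
    (fun k => P [set w | eps / modulus c <= modulus (Z k w - Y w)])).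
  by apply: ZY; rewrite divr_gt0.
apply/funext => k; congr (P _).
by apply/seteqP; split => w /=; rewrite cE ler_pdivrMr// mulrC.
Qed.

Lemma is_stochastic_integralD f f' Y Y' :
  is_stochastic_integral P m alpha W f Y ->
  is_stochastic_integral P m alpha W f' Y' ->
  is_stochastic_integral P m alpha W (fun x => f x + f' x) (fun w => Y w + Y' w).
Proof.
move=> [mf mY [s [fs sf sY]]] [mf' mY' [s' [fs' sf' sY']]]; split.
- exact: measurable_complexD.
- exact: measurable_complexD.
exists (fun k => s k ++ s' k); split.
- by move=> k p; rewrite mem_cat => /orP[/fs|/fs'].
- have [C C0 CD] := energyD m alpha_gt0 (ltr1n R 2 : 1 < 2).
  apply: (@squeeze_cvge _ _ _ _ (fun=> 0%E) _ (fun k =>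
    2%:E * energy m alpha (fun x => f x - simple_fun (s k) x)%R +
    C%:E * energy m alpha (fun x => f' x - simple_fun (s' k) x)%R)%E).
  + near=> k; rewrite energy_ge0/=.
    have := CD _ _ (measurable_complexB mf (measurable_simple_fun (fs k)))
      (measurable_complexB mf' (measurable_simple_fun (fs' k))).
    apply: le_trans; rewrite le_eqVlt; apply/orP; left; apply/eqP.
    apply: eq_integral => x _; congr ((modulus _ `^ _)%:E).
    by rewrite /simple_fun big_cat/= opprD addrACA.
  + exact: cvg_cst.
  + exact: (cvge0D (cvge0Zl 2 sf) (cvge0Zl C sf')).
- have := cvg_in_probabilityD (fun k => measurable_simple_integral W_SaS (fs k))
    (fun k => measurable_simple_integral W_SaS (fs' k)) mY mY' sY sY'.
  rewrite (_ : (fun k w => _) = (fun k => simple_integral W (s k ++ s' k)))//.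
  by apply/funext => k; apply/funext => w; rewrite /simple_integral big_cat.
Unshelve. all: by end_near. Qed.

Lemma is_stochastic_integralZ (c : R[i]) f Y :
  is_stochastic_integral P m alpha W f Y ->
  is_stochastic_integral P m alpha W (fun x => c * f x) (fun w => c * Y w).
Proof.
move=> [mf mY [s [fs sf sY]]]; split.
- exact: measurable_complexM (measurable_complex_cst _) _.
- exact: measurable_complexM (measurable_complex_cst _) _.
exists (fun k => [seq (c * p.1, p.2) | p <- s k]); split.
- by move=> k _ /mapP[p ps ->]; exact: (fs k p ps).
- rewrite (_ : (fun k => _) = (fun k => (modulus c `^ alpha)%:E *
      energy m alpha (fun x => f x - simple_fun (s k) x)%R)%E).
    exact: cvge0Zl.
  apply/funext => k.
  rewrite -(energyZ _ _ _ (measurable_complexB mf (measurable_simple_fun (fs k)))).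
  apply: eq_integral => x _; congr ((modulus _ `^ _)%:E).
  rewrite mulrBr /simple_fun big_map mulr_sumr; congr (_ - _).
  by apply: eq_bigr => p _; rewrite mulrA.
- have := cvg_in_probabilityZ c sY.
  rewrite (_ : (fun k w => _) =
      (fun k => simple_integral W [seq (c * p.1, p.2) | p <- s k]))//.
  apply/funext => k; apply/funext => w.
  rewrite /simple_integral big_map mulr_sumr; apply: eq_bigr => p _.
  by rewrite mulrA.
Qed.

Lemma is_stochastic_integral0 :
  is_stochastic_integral P m alpha W (fun=> 0) (fun=> 0).
Proof.
split; [exact: measurable_complex_cst|exact: measurable_complex_cst|].
exists (fun=> [::]); split=> //.
  rewrite (_ : (fun _ => _) = fun=> 0%E); first exact: cvg_cst.
  apply/funext => k; apply: integral0_eq => x _.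
  by rewrite /simple_fun big_nil subrr modulus0 powR0// gt_eqF.
move=> eps eps0; rewrite (_ : (fun _ => _) = fun=> 0%E); first exact: cvg_cst.
apply/funext => k; rewrite (_ : mkset _ = set0) ?measure0//.
apply/seteqP; split => w //=.
by rewrite /simple_integral big_nil subrr modulus0 leNgt eps0.
Qed.

Lemma is_stochastic_integral_sum (n : nat) (t : 'I_n -> R[i]) (f : 'I_n -> T -> R[i])
    (Y : 'I_n -> Omega -> R[i]) :
  (forall i, is_stochastic_integral P m alpha W (f i) (Y i)) ->
  is_stochastic_integral P m alpha W (fun x => \sum_i t i * f i x)
    (fun w => \sum_i t i * Y i w).
Proof.
move=> fY; elim: (index_enum _) => [|i s IHs].
  rewrite (_ : (fun x : T => _) = fun=> 0); last first.
    by apply/funext => x; rewrite big_nil.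
  rewrite (_ : (fun w : Omega => _) = fun=> 0); last first.
    by apply/funext => w; rewrite big_nil.
  exact: is_stochastic_integral0.
rewrite (_ : (fun x : T => _) = fun x => t i * f i x + \sum_(j <- s) t j * f j x);
  last by apply/funext => x; rewrite big_cons.
rewrite (_ : (fun w : Omega => _) = fun w => t i * Y i w + \sum_(j <- s) t j * Y j w);
  last by apply/funext => w; rewrite big_cons.
exact: is_stochastic_integralD (is_stochastic_integralZ _ (fY i)) IHs.
Qed.

(** The cosine is bounded and 1-Lipschitz: the difference of the expectations is at most
    eps / 2 plus twice the probability that Z k and Y differ by eps / 2 or more. *)
Lemma cvg_expectation_cos (Z : nat -> Omega -> R[i]) (Y : Omega -> R[i]) (b : R) :
  (forall k, measurable_complex (Z k)) -> measurable_complex Y ->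
  cvg_in_probability P Z Y ->
  \int[P]_w cos (complex.Re (Z k w) + b) @[k --> \oo] -->
  \int[P]_w cos (complex.Re (Y w) + b).
Proof.
move=> mZ mY ZY; apply/cvgrPdist_le => eps eps0.
pose A k := [set w | eps / 2 <= modulus (Z k w - Y w)].
have mA k : measurable (A k).
  by apply: measurable_modulus_ge; exact: measurable_complexB.
have e2 : 0 < eps / 2 by rewrite divr_gt0.
have /fine_cvgP[_ PA] := ZY _ e2.
have cos1 (x : R) : `|cos x| <= 1 by rewrite ler_norml cos_geN1 cos_le1.
near=> k.
have PAk : fine (P (A k)) <= eps / 4.
  by near: k; apply: (cvgr_le 0 PA); rewrite divr_gt0.
have icos (U : Omega -> R[i]) : measurable_complex U ->
    P.-integrable setT (EFin \o (fun w => cos (complex.Re (U w) + b))).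
  move=> mU; apply: (@bounded_integrable _ _ _ _ _ 1) => //.
  exact/measurable_cosDr/measurable_Re.
have idiff : P.-integrable setT (EFin \o
    (fun w => cos (complex.Re (Y w) + b) - cos (complex.Re (Z k w) + b))).
  by have := integrableB measurableT (icos _ mY) (icos _ (mZ k)).
rewrite -RintegralB//; [|exact: icos|exact: icos].
apply: (le_trans (le_normr_Rintegral measurableT idiff)).
have iA : P.-integrable setT (EFin \o (fun w => \1_(A k) w : R)).
  apply: (@bounded_integrable _ _ _ _ _ 1) => [|w]; first exact: measurable_indic.
  by rewrite indicE ger0_norm ?lern1 ?leq_b1.
have iA2 : P.-integrable setT (EFin \o (fun w => 2 * \1_(A k) w)).
  by have := integrableZl measurableT 2 iA.
have icst : P.-integrable setT (EFin \o (fun=> eps / 2)).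
  exact: finite_measure_integrable_cst.
apply: (@le_trans _ _ (\int[P]_w (eps / 2 + 2 * \1_(A k) w))).
  apply: le_Rintegral => //.
  - by have := integrable_norm idiff.
  - by have := integrableD measurableT icst iA2.
  move=> w _; rewrite indicE.
  have [Aw|nAw] := pselect (A k w).
    rewrite mem_set// mulr1.
    apply: (@le_trans _ _ (1 + 1)); last by rewrite lerDr ltW.
    by rewrite (le_trans (ler_normB _ _))// lerD.
  rewrite memNset// mulr0 addr0 (le_trans (cos_lipschitz _ _))//.
  have : modulus (Z k w - Y w) < eps / 2 by rewrite ltNge; apply/negP.
  move=> /ltW; apply: le_trans.
  rewrite -modulusN; apply: le_trans (modulus_Re _).
  by rewrite opprB opprD addrACA subrr addr0; case: (Y w); case: (Z k w).
rewrite RintegralD// Rintegral_cst// RintegralZl// Rintegral_indic//.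
rewrite (_ : fine (P setT) = 1); last exact: (congr1 fine (probability_setT P)).
rewrite mulr1 [leRHS](splitr eps) lerD2l mulrC -ler_pdivlMr//.
by rewrite (le_trans PAk)// -mulrA -invfM -natrM.
Unshelve. all: by end_near. Qed.

(** The characteristic function of a stochastic integral is the limit of those of the
    approximating simple integrals, since their energies converge. *)
Theorem expectation_cos_stochastic_integral f Y (b : R) :
  is_stochastic_integral P m alpha W f Y ->
  \int[P]_w cos (complex.Re (Y w) + b) =
  cos b * expR (- (c0 * fine (energy m alpha f))).
Proof.
move=> [mf mY [s [fs sf sY]]].
have ms k := measurable_simple_fun (fs k).
have [_ es] := cvg_energy alpha_gt0 mf ms
  (fun k => integral_simple_fun_fin alpha_gt0 (fs k)) sf.
have c1 := @cvg_expectation_cos _ _ b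
  (fun k => measurable_simple_integral W_SaS (fs k)) mY sY.
have c2 : cos b * expR (- (c0 * fine (energy m alpha (simple_fun (s k)))))
    @[k --> \oo] --> cos b * expR (- (c0 * fine (energy m alpha f))).
  apply: cvgMl_tmp; apply: continuous_cvg; first exact: continuous_expR.
  by apply: cvgN; exact: cvgMl_tmp.
have e : (fun k => \int[P]_w cos (complex.Re (simple_integral W (s k) w) + b)) =
    (fun k => cos b * expR (- (c0 * fine (energy m alpha (simple_fun (s k)))))).
  apply/funext => k.
  exact: (expectation_cos_simple_integral W_SaS alpha_gt0 (fs k)).
by rewrite e in c1; exact: (cvg_unique _ c1 c2).
Qed.

End stochastic_integral.

(** * Operator scaling and stationary increments *)

(** Real linear combinations of stochastic integrals are stochastic integrals, so their
    cosine expectations depend on the energies of the combined kernels only, and these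
    expectations determine the finite-dimensional distributions. *)
Lemma same_fdd_stochastic_integral (R : realType) (d d' : measure_display)
    (Omega : measurableType d) (T : measurableType d')
    (P : probability Omega R) (m : {measure set T -> \bar R}) (alpha c0 : R)
    (W : set T -> Omega -> R[i]) (I : Type) (f g : I -> T -> R[i])
    (Y Z : I -> Omega -> R[i]) :
  isotropic_SaS_random_measure P m alpha c0 W -> 0 < alpha ->
  (forall x, is_stochastic_integral P m alpha W (f x) (Y x)) ->
  (forall x, is_stochastic_integral P m alpha W (g x) (Z x)) ->
  (forall n (x : 'I_n -> I) (t : 'I_n -> R),
    energy m alpha (fun xi => \sum_i (t i)%:C%C * f (x i) xi) =
    energy m alpha (fun xi => \sum_i (t i)%:C%C * g (x i) xi)) ->
  same_fdd P (fun x w => complex.Re (Y x w)) (fun x w => complex.Re (Z x w)).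
Proof.
move=> W_SaS alpha0 fY gZ fg n x B mB.
have Re_comb (V : I -> Omega -> R[i]) (t : 'I_n -> R) w :
    complex.Re (\sum_i (t i)%:C%C * V (tnth x i) w) =
    \sum_i t i * complex.Re (V (tnth x i) w).
  rewrite Re_sum; apply: eq_bigr => i _.
  by case: (V _ w) => a b /=; rewrite mul0r subr0.
apply: (eq_distribution (U := fun i w => complex.Re (Y (tnth x i) w))
  (V := fun i w => complex.Re (Z (tnth x i) w))) => //.
- by move=> i; apply: measurable_Re; have [] := fY (tnth x i).
- by move=> i; apply: measurable_Re; have [] := gZ (tnth x i).
move=> t b.
under eq_Rintegral do rewrite -Re_comb.
under [in RHS]eq_Rintegral do rewrite -Re_comb.
rewrite (expectation_cos_stochastic_integral W_SaS alpha0 b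
  (is_stochastic_integral_sum W_SaS alpha0 (fun i => (t i)%:C%C) (fun i => fY (tnth x i)))).
rewrite (expectation_cos_stochastic_integral W_SaS alpha0 b
  (is_stochastic_integral_sum W_SaS alpha0 (fun i => (t i)%:C%C) (fun i => gZ (tnth x i)))).
by rewrite fg.
Qed.

Section kernel.
Context {R : realType} {d : nat}.
Implicit Types (x h xi : 'cV[R]_d).

Lemma innerE x xi : inner x xi = (x^T *m xi) 0 0.
Proof. by rewrite mxE; apply: eq_bigr => i _; rewrite mxE. Qed.

Lemma inner_mull (A : 'M[R]_d) x xi : inner (A *m x) xi = inner x (A^T *m xi).
Proof. by rewrite !innerE trmx_mul mulmxA. Qed.

Lemma innerDl x h xi : inner (x + h) xi = inner x xi + inner h xi.
Proof. by rewrite !innerE linearD mulmxDl mxE. Qed.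

Lemma inner0r x : inner x 0 = 0.
Proof. by rewrite innerE mulmx0 mxE. Qed.

Lemma mpow_tr (c : R) (A : 'M[R]_d) : (mpow c A)^T = mpow c A^T.
Proof. by rewrite /mpow -mexp_tr linearZ. Qed.

Lemma det_mpow (c : R) (A : 'M[R]_d) : 0 < c -> \det (mpow c A) = c `^ \tr A.
Proof. by move=> c0; rewrite /mpow det_mexp mxtraceZ /powR gt_eqF// mulrC. Qed.

Lemma expiD (a b : R) : expi (a + b) = expi a * expi b.
Proof.
rewrite /expi cosD sinD; apply/eqP; rewrite eq_complex /= eqxx/=.
by rewrite addrC mulrC eqxx.
Qed.

(** Translation in x multiplies the kernel by a phase, which does not change the modulus
    of a linear combination of kernels. *)
Lemma kernel_shift (psi : 'cV[R]_d -> R) (beta : R) x h xi :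
  harmonizable_kernel psi beta (x + h) xi - harmonizable_kernel psi beta h xi =
  expi (inner h xi) * harmonizable_kernel psi beta x xi.
Proof.
rewrite /harmonizable_kernel innerDl expiD -mulrBl opprB addrA subrK mulrA.
by rewrite mulrBr mulr1 [X in _ = (X - _) * _]mulrC.
Qed.

(** The adjoint moves the matrix power to the frequency variable, where the homogeneity
    of psi turns it into a constant factor; at xi = 0 both sides vanish. *)
Lemma kernel_scale (E : 'M[R]_d) (psi : 'cV[R]_d -> R) (beta c : R) x xi :
  (forall x, 0 <= psi x) -> homogeneous E^T psi -> 0 < c ->
  harmonizable_kernel psi beta (mpow c E *m x) xi =
  (c `^ - beta)%:C%C * harmonizable_kernel psi beta x (mpow c E^T *m xi).
Proof.
move=> psi0 hpsi c0; rewrite /harmonizable_kernel inner_mull mpow_tr.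
have [->|xi0] := eqVneq xi 0.
  by rewrite mulmx0 inner0r /expi cos0 sin0 subrr !mul0r mulr0.
rewrite hpsi// powRM ?(ltW c0)// [in RHS]mulrCA; congr (_ * _).
rewrite -rmorphM/= mulrA -powRD ?addNr ?powRr0 ?mul1r//.
by rewrite (gt_eqF c0) implybT.
Qed.

End kernel.

Theorem corollary4p2 (R : realType) (d : nat) (E : 'M[R]_d) (a1 : R)
  (eigenvalues_pos : forall z : R[i], is_complex_eigenvalue E z ->
     0 < complex.Re z)
  (a1_attained : exists2 z : R[i], is_complex_eigenvalue E z &
     complex.Re z = a1)
  (a1_smallest : forall z : R[i], is_complex_eigenvalue E z ->
     a1 <= complex.Re z)
  (psi : 'cV[R]_d -> R)
  (psi_ge0 : forall x, 0 <= psi x)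
  (psi_continuous : continuous psi)
  (psi_homogeneous : homogeneous E^T psi)
  (psi_neq0 : forall x, x != 0 -> psi x != 0)
  (alpha H : R)
  (alpha_gt0 : 0 < alpha) (alpha_le2 : alpha <= 2)
  (H_gt0 : 0 < H) (H_lt : H < a1)
  (disp : measure_display) (Omega : measurableType disp)
  (P : probability Omega R)
  (c0 : R) (c0_gt0 : 0 < c0)
  (W : set 'cV[R]_d -> Omega -> R[i])
  (W_SaS : isotropic_SaS_random_measure P (lebesgue_cV d) alpha c0 W)
  (Z : 'cV[R]_d -> Omega -> R[i])
  (Z_integral : forall x : 'cV[R]_d,
     is_stochastic_integral P (lebesgue_cV d) alpha W
       (harmonizable_kernel psi (- H - \tr E / alpha) x) (Z x))
  (X : 'cV[R]_d -> Omega -> R)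
  (X_def : forall x w, X x w = complex.Re (Z x w)) :
  (forall c : R, 0 < c ->
     same_fdd P (fun x => X (mpow c E *m x))
                (fun x w => c `^ H * X x w)) /\
  (forall h : 'cV[R]_d,
     same_fdd P (fun x w => X (x + h) w - X h w) X).
Proof.
have -> : X = fun x w => complex.Re (Z x w).
  by apply/funext => x; apply/funext => w.
set beta := - H - \tr E / alpha in Z_integral *.
split=> [c c_gt0|h].
- rewrite (_ : (fun x w => c `^ H * _) =
      (fun x w => complex.Re ((c `^ H)%:C%C * Z x w))); last first.
    apply/funext => x; apply/funext => w.
    by case: (Z x w) => a b /=; rewrite mul0r subr0.
  apply: (same_fdd_stochastic_integral W_SaS alpha_gt0
    (fun x => Z_integral (mpow c E *m x))
    (fun x => is_stochastic_integralZ (c `^ H)%:C%C (Z_integral x))) => n x t.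
  pose F xi := \sum_i (t i)%:C%C * harmonizable_kernel psi beta (x i) xi.
  have mF : measurable_complex F.
    apply: measurable_complex_sum => i _; apply: measurable_complexM.
      exact: measurable_complex_cst.
    by have [] := Z_integral (x i).
  set M := mpow c E^T.
  have detM : \det M = c `^ \tr E by rewrite det_mpow// mxtrace_tr.
  have uM : M \in unitmx by rewrite unitmxE unitfE detM gt_eqF// powR_gt0.
  have FM : measurable_complex (fun xi => F (M *m xi)).
    by apply: (measurableT_comp mF); exact: measurable_linear.
  transitivity (energy (lebesgue_cV d) alpha
      (fun xi => (c `^ - beta)%:C%C * F (M *m xi))).
    apply: eq_integral => xi _; congr ((modulus _ `^ _)%:E).
    rewrite /F mulr_sumr; apply: eq_bigr => i _.
    by rewrite kernel_scale// mulrCA.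
  transitivity (energy (lebesgue_cV d) alpha (fun xi => (c `^ H)%:C%C * F xi)); last first.
    apply: eq_integral => xi _; congr ((modulus _ `^ _)%:E).
    by rewrite /F mulr_sumr; apply: eq_bigr => i _; rewrite mulrCA.
  rewrite (energyZ _ _ _ FM) (energyZ _ _ _ mF).
  have -> : energy (lebesgue_cV d) alpha (fun xi => F (M *m xi)) =
      ((`|\det M|^-1)%R%:E * energy (lebesgue_cV d) alpha F)%E.
    apply: (lebesgue_scaling_unit uM (f := fun xi => (modulus (F xi) `^ alpha)%:E)).
      exact: measurable_modulus_powR.
    by move=> xi; rewrite lee_fin powR_ge0.
  have assoc (a b k : R) (e : \bar R) : a * b = k ->
      (a%:E * (b%:E * e) = k%:E * e)%E by move=> <-; rewrite muleA.
  apply: assoc.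
  (* The exponents agree: - beta * alpha = H * alpha + \tr E, and \tr E is cancelled by
     the Jacobian of M. *)
  rewrite !modulus_real detM !ger0_norm ?powR_ge0//.
  rewrite -!powRrM -powRN -powRD ?(gt_eqF c_gt0) ?implybT//.
  congr (_ `^ _).
  by rewrite /beta; field; rewrite gt_eqF.
have ReB x w : complex.Re (Z (x + h) w) - complex.Re (Z h w) =
    complex.Re (Z (x + h) w + (- 1) * Z h w).
  by rewrite mulN1r; case: (Z _ w); case: (Z _ w).
rewrite (_ : (fun x w => _ - _) =
    (fun x w => complex.Re (Z (x + h) w + (- 1) * Z h w))); last first.
  by apply/funext => x; apply/funext => w.
apply: (same_fdd_stochastic_integral W_SaS alpha_gt0
  (fun x => is_stochastic_integralD W_SaS alpha_gt0 (Z_integral (x + h))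
    (is_stochastic_integralZ (- 1) (Z_integral h)))
  Z_integral) => n x t; apply: eq_integral => xi _; congr (_%:E).
rewrite -[in RHS](mul1r (modulus _)) -(modulus_expi (inner h xi)) -modulusM.
congr (modulus _ `^ _); rewrite mulr_sumr; apply: eq_bigr => i _.
by rewrite mulN1r kernel_shift mulrCA.
Qed.
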